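(* Fix $m\ge 2$, $n\in\{2,\dots,m\}$, a predictor $F$ (with marginals $F_1,F_2$) and a set $\mathcal I$ of bidders with $|\mathcal I|=n$. Define $$g(v;\mathcal I,n,F)=\binom{m}{n}\,\psi(v;n,F)\prod_{j\in\mathcal I}f_1(v_j),\qquad v\in[0,1]^n .$$ (i) $g(\cdot;\mathcal I,n,F)$ is the unique (almost everywhere) symmetric joint density over valuations $v\in[0,1]^n$ whose conditional densities satisfy $g(v_{-i}\mid v_i;\mathcal I,n,F)=\beta(v_{-i}\mid \mathcal I,v_i;n,F)$ for every $i\in\mathcal I$ and every $v\in[0,1]^n$. (ii) For any given auction format, the auction with prescreening that admits $n$ out of $m$ potential bidders under the i.i.d. prior $f_1$ and predictor $F$ is equivalent to the standard auction (no prescreening) of the same format with $n$ bidders whose valuation vector is drawn from the joint density $g(\cdot;\mathcal I,n,F)$, each bidder observing only her own valuation. Equivalence means: the bidders' beliefs about the other participants' valuations (conditional on their own), the equilibrium strategies, and the seller's ex-ante expected utility are identical in the two settings.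
   Context: Model. There are $m\ge2$ risk-neutral potential bidders, forming the set $\mathcal I^0$. The valuation–signal pairs $(V_i,S_i)\in[0,1]^2$ are independent across bidders with common joint CDF $F$ (the ''predictor''). The marginal CDFs $F_1$ (valuations) and $F_2$ (signals) have strictly positive densities $f_1,f_2$ on $[0,1]$; $F_{2\mid1}(s\mid v)=\Pr(S_i\le s\mid V_i=v)$. Standing assumption: $\mathbb E[V_i\mid S_i=s]$ is non-decreasing in $s$. Bidder $i$ observes only $V_i$; only the seller observes the signals. The seller commits, before any realization, to a number $n\in\{2,\dots,m\}$, and after seeing signals admits the $n$ bidders with the highest $\mathbb E[V_i\mid S_i=s_i]$; under the standing assumption this is the ranking by signals, so ''$\mathcal I$ is the admitted set'' means $\max_{j\in\mathcal I^0\setminus\mathcal I}S_j\le\min_{k\in\mathcal I}S_k$. Admitted bidders observe the admitted set and update beliefs by Bayes' rule. Admission probability: for $v=(v_k)_{k\in\mathcal I}\in[0,1]^n$, $$\psi(v;n,F)=\Pr\Big\{\max_{j\in\mathcal I^0\setminus\mathcal I}S_j\le\min_{k\in\mathcal I}S_k\ \Big|\ V_{\mathcal I}=v\Big\}=\int_0^1\prod_{k\in\mathcal I}[1-F_{2\mid1}(x\mid v_k)]\,d\big(F_2(x)^{m-n}\big)$$ if $n<m$, and $\psi\equiv1$ if $n=m$. $\beta(v_{-i}\mid\mathcal I,v_i;n,F)$ denotes the posterior joint density that admitted bidder $i$ assigns to the valuations $v_{-i}=(v_j)_{j\in\mathcal I\setminus\{i\}}$ of the other admitted bidders, given the admitted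 set $\mathcal I$ and her own valuation $v_i$ (predictor $F$). The seller's ex-ante expected utility is the expectation, taken before any realization, of a (measurable) payoff depending on the admitted bidders' valuations through the outcome of play. A density is symmetric if it is invariant under permutations of its arguments. *)

(* Defs.v *)
From HB Require Import structures.
From mathcomp Require Import all_boot all_order all_algebra perm.
From mathcomp Require Import all_classical all_reals all_analysis.

Set Implicit Arguments.
Unset Strict Implicit.
Unset Printing Implicit Defensive.

Import Order.TTheory GRing.Theory Num.Theory.
Import numFieldNormedType.Exports.

Local Open Scope classical_set_scope.
Local Open Scope ring_scope.

Definition unit_itv (R : realType) : set R := `[0, 1].
Arguments unit_itv : clear implicits.

Definition cube (R : realType) (n : nat) : set (n.-tuple R) :=
  [set v | forall k, unit_itv R (tnth v k)].
Arguments cube : clear implicits.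

(* [others k v] is v_{-k}; [join k x w] is the vector whose k-th entry is [x]
   and whose remaining entries are [w]. *)
Definition others (T : Type) (n : nat) (k : 'I_n) (v : n.-tuple T) :
  n.-1.-tuple T := [tuple tnth v (lift k j) | j < n.-1].

Definition join (T : Type) (n : nat) (k : 'I_n) (x : T) (w : n.-1.-tuple T) :
  n.-tuple T := [tuple (if unlift k j is Some l then tnth w l else x) | j < n].

Definition tcons (R : realType) (n : nat) (p : n.-tuple R * R) :
  n.+1.-tuple R := [the n.+1.-tuple R of p.2 :: p.1].

Lemma measurable_tcons (R : realType) (n : nat) :
  measurable_fun [set: n.-tuple R * R] (@tcons R n).
Proof. exact: measurable_cons. Qed.

Section TconsMeasure.
Variables (R : realType) (n : nat) (mu : {measure set (n.-tuple R) -> \bar R}).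

(* mu (x) Lebesgue, transported to (n+1)-vectors *)
Definition tcons_measure : set (n.+1.-tuple R) -> \bar R :=
  pushforward (mu \x lebesgue_measure)%E (@tcons R n).

Let measurable_preimage A : measurable A -> measurable (@tcons R n @^-1` A).
Proof. by move=> mA; rewrite -[X in measurable X]setTI; exact: measurable_tcons. Qed.

Let tcons_measure0 : tcons_measure set0 = 0%E.
Proof. by rewrite /tcons_measure /pushforward preimage_set0 measure0. Qed.

Let tcons_measure_ge0 A : (0 <= tcons_measure A)%E.
Proof. by rewrite /tcons_measure /pushforward measure_ge0. Qed.

Let tcons_measure_sigma_additive : semi_sigma_additive tcons_measure.
Proof.
move=> A mA tA mUA; rewrite /tcons_measure /pushforward preimage_bigcup.
apply: measure_semi_sigma_additive.
- by move=> k; exact: measurable_preimage.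
- apply/trivIsetP => /= i j _ _ ij; rewrite -preimage_setI.
  by move/trivIsetP : tA => /(_ _ _ _ _ ij) ->//; rewrite preimage_set0.
- by rewrite -preimage_bigcup; exact: measurable_preimage.
Qed.

HB.instance Definition _ := isMeasure.Build _ _ _ tcons_measure
  tcons_measure0 tcons_measure_ge0 tcons_measure_sigma_additive.

End TconsMeasure.

(* n-dimensional Lebesgue measure *)
Fixpoint tuple_lebesgue (R : realType) (n : nat) :
    {measure set (n.-tuple R) -> \bar R} :=
  match n with
  | 0 => \d_ [tuple]
  | n'.+1 => tcons_measure (tuple_lebesgue R n')
  end.

(* The joint CDF [F] is represented by its law [law]. The densities are only
   relevant on [0, 1]. [signal_kernel v] is (a fixed version of) the conditional
   law of the signal given that the valuation is [v]. *)
Record predictor (R : realType) := Predictor {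
  law : probability (R * R)%type R ;
  f1 : R -> R ;
  f2 : R -> R ;
  signal_kernel : R.-pker R ~> R ;
  law_unit_square : law (unit_itv R `*` unit_itv R) = 1%E ;
  measurable_f1 : measurable_fun (unit_itv R) f1 ;
  measurable_f2 : measurable_fun (unit_itv R) f2 ;
  f1_gt0 : forall x, unit_itv R x -> 0 < f1 x ;
  f2_gt0 : forall s, unit_itv R s -> 0 < f2 s ;
  f1_density : forall A : set R, measurable A ->
    law (A `*` setT) = (\int[lebesgue_measure]_(x in A `&` unit_itv R) (f1 x)%:E)%E ;
  f2_density : forall B : set R, measurable B ->
    law (setT `*` B) = (\int[lebesgue_measure]_(s in B `&` unit_itv R) (f2 s)%:E)%E ;
  signal_kernelE : forall A B : set R, measurable A -> measurable B ->
    law (A `*` B) =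
    (\int[lebesgue_measure]_(x in A `&` unit_itv R) (signal_kernel x B * (f1 x)%:E))%E ;
  (* a version of s |-> E[V | S = s] is nondecreasing *)
  posterior_mean_nondecreasing : exists e : R -> R,
    (forall s t, unit_itv R s -> unit_itv R t -> s <= t -> e s <= e t) /\
    (forall B : set R, measurable B ->
      (\int[law]_(p in setT `*` B) (p.1)%:E =
       \int[lebesgue_measure]_(s in B `&` unit_itv R) (e s * f2 s)%:E)%E)
}.

(* F_{2|1}(s | v) *)
Definition cond_signal_cdf (R : realType) (F : predictor R) (s v : R) : R :=
  fine (signal_kernel F v `]-oo, s]%classic).

(* F_2 *)
Definition signal_cdf (R : realType) (F : predictor R) (s : R) : R :=
  fine (law F (setT `*` `]-oo, s]%classic)).

Definition signal_cdf_pow (R : realType) (F : predictor R) (k : nat) (s : R) : R :=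
  signal_cdf F s ^+ k.

Section SignalCdf.
Variables (R : realType) (F : predictor R).

Lemma signal_cdf_ge0 s : 0 <= signal_cdf F s.
Proof. by rewrite /signal_cdf fine_ge0. Qed.

Let sndRV : R * R -> R := snd.
#[local] HB.instance Definition _ :=
  @isMeasurableFun.Build _ _ _ _ sndRV (@measurable_snd _ _ _ _).

Let signal_cdfE s :
  signal_cdf F s = fine (cdf (sndRV : {RV (law F) >-> R}) s).
Proof.
rewrite /signal_cdf /cdf /distribution /pushforward; congr (fine (law F _)).
by apply/seteqP; split => -[x y] /=; [case | move=> ?; split].
Qed.

Lemma signal_cdf_nondecreasing : nondecreasing (signal_cdf F).
Proof.
move=> s t st; rewrite !signal_cdfE fine_le ?fin_num_measure//.
exact: cdf_nondecreasing.
Qed.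

Lemma signal_cdf_right_continuous : right_continuous (signal_cdf F).
Proof.
move=> a; rewrite (_ : signal_cdf F = fine \o cdf (sndRV : {RV (law F) >-> R})).
  apply: fine_cvg; rewrite fineK ?fin_num_measure//.
  exact: cdf_right_continuous.
by apply/funext => s; rewrite /= signal_cdfE.
Qed.

Lemma signal_cdf_pow_nondecreasing k : nondecreasing (signal_cdf_pow F k).
Proof.
move=> s t st; apply: lerXn2r; rewrite ?nnegrE ?signal_cdf_ge0//.
exact: signal_cdf_nondecreasing.
Qed.

Lemma signal_cdf_pow_right_continuous k : right_continuous (signal_cdf_pow F k).
Proof.
elim: k => [|k IHk] a; first exact: cvg_cst.
rewrite (_ : signal_cdf_pow F k.+1 = signal_cdf F \* signal_cdf_pow F k); last first.
  by apply/funext => s; rewrite /signal_cdf_pow /= exprS.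
by apply: cvgM; [exact: signal_cdf_right_continuous | exact: IHk].
Qed.

End SignalCdf.

HB.instance Definition _ (R : realType) (F : predictor R) (k : nat) :=
  isCumulative.Build R _ R (signal_cdf_pow F k)
    (@signal_cdf_pow_nondecreasing R F k)
    (@signal_cdf_pow_right_continuous R F k).

Definition nset (m n : nat) := {I : {set 'I_m} | #|I| == n}.

(* the k-th element of I, in increasing order; this identifies the index set
   I of the admitted bidders with 'I_n *)
Definition bidder (m n : nat) (I : nset m n) (k : 'I_n) : 'I_m :=
  enum_val (cast_ord (esym (eqP (valP I))) k).

(* psi(v; n, F), for m potential bidders *)
Definition psi (R : realType) (m n : nat) (F : predictor R) (v : n.-tuple R) : R :=
  if (n < m)%N then
    fine (\int[lebesgue_stieltjes_measure (signal_cdf_pow F (m - n))]_(x in unit_itv R)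
      (\prod_(k < n) (1 - cond_signal_cdf F x (tnth v k)))%:E)%E
  else 1.

(* g(v; I, n, F); [I] only enters through the labelling of the coordinates. *)
Definition joint_density (R : realType) (m n : nat) (F : predictor R)
    (I : nset m n) (v : n.-tuple R) : R :=
  'C(m, n)%:R * psi m F v * \prod_(k < n) f1 F (tnth v k).

Definition is_density (R : realType) (n : nat) (h : n.-tuple R -> R) : Prop :=
  [/\ measurable_fun (cube R n) h,
      (forall v, cube R n v -> 0 <= h v) &
      (\int[tuple_lebesgue R n]_(v in cube R n) (h v)%:E = 1)%E].

Definition is_symmetric (R : realType) (n : nat) (h : n.-tuple R -> R) : Prop :=
  forall (s : {perm 'I_n}) (v : n.-tuple R), cube R n v ->
    h [tuple tnth v (s k) | k < n] = h v.

Definition marginal_density (R : realType) (n : nat) (h : n.-tuple R -> R)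
    (k : 'I_n) (x : R) : R :=
  fine (\int[tuple_lebesgue R n.-1]_(w in cube R n.-1) (h (join k x w))%:E)%E.

(* h(v_{-k} | v_k), as a function of v_k = x and v_{-k} = w *)
Definition cond_density (R : realType) (n : nat) (h : n.-tuple R -> R)
    (k : 'I_n) (x : R) (w : n.-1.-tuple R) : R :=
  h (join k x w) / marginal_density h k x.

(* Bayes' rule for beta(w | I, v_k = x; n, F): psi is the likelihood of the
   event that I is admitted, and the prior of v_{-k} given v_k is i.i.d. f1. *)
Definition bayes_posterior (R : realType) (m n : nat) (F : predictor R)
    (I : nset m n) (k : 'I_n) (x : R) (w : n.-1.-tuple R) : R :=
  let joint w' := psi m F (join k x w') * \prod_(j < n.-1) f1 F (tnth w' j) in
  joint w / fine (\int[tuple_lebesgue R n.-1]_(w' in cube R n.-1) (joint w')%:E)%E.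

(* [b x w] is (a version of) the conditional density at w of the others'
   valuations W_{-k}, given the event E and own valuation W_k = x. *)
Record is_belief (R : realType) (n : nat) d (T : measurableType d)
    (P : probability T R) (E : set T) (W : T -> n.-tuple R) (k : 'I_n)
    (b : R -> n.-1.-tuple R -> R) : Prop := IsBelief {
  measurable_belief :
    measurable_fun (unit_itv R `*` cube R n.-1) (fun p => b p.1 p.2) ;
  belief_ge0 : forall x w, unit_itv R x -> cube R n.-1 w -> 0 <= b x w ;
  beliefE : forall (A : set R) (B : set (n.-1.-tuple R)),
    measurable A -> measurable B -> A `<=` unit_itv R -> B `<=` cube R n.-1 ->
    P (E `&` [set t | A (tnth (W t) k) /\ B (others k (W t))]) =
    (\int[P]_(t in E `&` [set t | A (tnth (W t) k)])
      \int[tuple_lebesgue R n.-1]_(w in B) (b (tnth (W t) k) w)%:E)%E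
}.

(* The prescreening environment: [adm t] is the set admitted in state t. *)
Record prescreening (R : realType) (m n : nat) (F : predictor R)
    d (T : measurableType d) (P : probability T R)
    (V S : 'I_m -> {RV P >-> R}) (adm : T -> nset m n) : Prop := Prescreening {
  pair_law : forall (i : 'I_m) (E : set (R * R)), measurable E ->
    P [set t | E (V i t, S i t)] = law F E ;
  pairs_independent : forall (J : {set 'I_m}) (E : 'I_m -> set (R * R)),
    (forall i, measurable (E i)) ->
    P [set t | forall i, i \in J -> E i (V i t, S i t)] =
    (\prod_(i in J) P [set t | E i (V i t, S i t)])%E ;
  measurable_adm : forall I, measurable (adm @^-1` [set I]) ;
  adm_top : forall t j k, j \notin val (adm t) -> k \in val (adm t) ->
    S j t <= S k t
}.

Definition admitted_valuations (R : realType) (m n : nat)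
    d (T : measurableType d) (P : probability T R) (V : 'I_m -> {RV P >-> R})
    (I : nset m n) (t : T) : n.-tuple R :=
  [tuple V (bidder I k) t | k < n].

(* The valuation vector W of a standard auction has joint density h. *)
Definition has_joint_density (R : realType) (n : nat) d (T : measurableType d)
    (P : probability T R) (W : {mfun T >-> n.-tuple R}) (h : n.-tuple R -> R) : Prop :=
  forall B : set (n.-tuple R), measurable B ->
    P (W @^-1` B) = (\int[tuple_lebesgue R n]_(v in B `&` cube R n) (h v)%:E)%E.

(* A format in normal form: [win k a] and [pay k a] are the winning probability
   and expected payment of participant k under the action profile a, and
   [seller a] is the seller's payoff. *)
Record auction_format (R : realType) (n : nat) d (A : measurableType d) :=
  AuctionFormat {
  win : 'I_n -> {mfun n.-tuple A >-> R} ;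
  pay : 'I_n -> {mfun n.-tuple A >-> R} ;
  seller : {mfun n.-tuple A >-> R}
}.

Section Auctions.
Variables (R : realType) (n : nat) (dA : measure_display) (A : measurableType dA).

Definition strategy_profile := 'I_n -> {mfun R >-> A}.

Definition play (sigma : strategy_profile) (v : n.-tuple R) : n.-tuple A :=
  [tuple sigma k (tnth v k) | k < n].

Definition play_others (sigma : strategy_profile) (k : 'I_n)
    (w : n.-1.-tuple R) : n.-1.-tuple A :=
  [tuple sigma (lift k j) (tnth w j) | j < n.-1].

(* expected payoff of participant k with valuation x, belief density b x and
   action a, when the others follow sigma *)
Definition interim_payoff (fmt : auction_format R n A) (sigma : strategy_profile)
    (k : 'I_n) (b : R -> n.-1.-tuple R -> R) (x : R) (a : A) : \bar R :=
  (\int[tuple_lebesgue R n.-1]_(w in cube R n.-1)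
    ((x * win fmt k (join k a (play_others sigma k w))
      - pay fmt k (join k a (play_others sigma k w))) * b x w)%:E)%E.

(* Bayes-Nash equilibrium among participants with valuation vector W, after the
   event E has become common knowledge *)
Definition equilibrium d (T : measurableType d) (P : probability T R) (E : set T)
    (W : T -> n.-tuple R) (fmt : auction_format R n A)
    (sigma : strategy_profile) : Prop :=
  forall k : 'I_n, exists2 b : R -> n.-1.-tuple R -> R,
    is_belief P E W k b &
    {ae lebesgue_measure, forall x, unit_itv R x -> forall a : A,
      (interim_payoff fmt sigma k b x a <=
       interim_payoff fmt sigma k b x (sigma k x))%E}.

(* Admitted bidders observe the admitted set, so their strategies may depend on
   it; the set I is admitted on the event adm = I. *)
Definition prescreening_equilibrium (m : nat) d (T : measurableType d)
    (P : probability T R) (V : 'I_m -> {RV P >-> R}) (adm : T -> nset m n)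
    (fmt : auction_format R n A) (s : nset m n -> strategy_profile) : Prop :=
  forall I : nset m n,
    equilibrium P (adm @^-1` [set I]) (admitted_valuations V I) fmt (s I).

Definition standard_equilibrium d (T : measurableType d) (P : probability T R)
    (W : T -> n.-tuple R) (fmt : auction_format R n A)
    (sigma : strategy_profile) : Prop :=
  equilibrium P setT W fmt sigma.

Definition prescreening_seller_utility (m : nat) d (T : measurableType d)
    (P : probability T R) (V : 'I_m -> {RV P >-> R}) (adm : T -> nset m n)
    (fmt : auction_format R n A) (s : nset m n -> strategy_profile) : \bar R :=
  (\int[P]_t (seller fmt (play (s (adm t)) (admitted_valuations V (adm t) t)))%:E)%E.

Definition standard_seller_utility d (T : measurableType d) (P : probability T R)
    (W : T -> n.-tuple R) (fmt : auction_format R n A)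
    (sigma : strategy_profile) : \bar R :=
  (\int[P]_t (seller fmt (play sigma (W t)))%:E)%E.

End Auctions.

(* Main.v *)
(* Let M be the best rejected signal and Z the worst admitted one. They are
   independent and M has CDF F_2^(m-n), so Tonelli's theorem gives, for every set
   I and every measurable B,
     P(I is admitted, V_I in B) = int_B psi(v) prod_k f_1(v_k) dv,
   up to ties, which are null because signals have a density. The right-hand side
   does not depend on I, hence each set is admitted with probability 1/C(m,n), and
   the law of V_I given that I is admitted has density g. Beliefs, equilibria and
   utilities depend on that law only, whence (ii).
   For (i), psi > 0 almost everywhere because S > 0 almost surely. If h has the
   conditional densities of g, then h(v) = r_k(v_k) g(v) for every coordinate k;
   comparing two coordinates, r_0(v_0) = r_1(v_1) almost everywhere, so both are
   constant, and the constant is 1 by normalization. *)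

Require Import Defs.
From HB Require Import structures.
From mathcomp Require Import all_boot all_order all_algebra perm.
From mathcomp Require Import all_classical all_reals all_analysis measurable_realfun.

Set Implicit Arguments.
Unset Strict Implicit.
Unset Printing Implicit Defensive.

Import Order.TTheory GRing.Theory Num.Theory.
Import numFieldNormedType.Exports.

Local Open Scope classical_set_scope.
Local Open Scope ring_scope.

(** Identities between laws are checked on a generating class stable under intersection (rectangles
    for valuation vectors, quadrants [X < a], [b <= Y] for the pair M, Z), because independence and
    beliefs are assumptions about product events only. Two conventions need care: [fine] sends an
    infinite marginal to 0, and division by 0 gives 0. Hence relations between a joint density and
    its conditionals are first proved in product form, and quotients are taken where the marginal is
    known to be positive or where both sides degenerate alike. *)

Lemma measurable_preimage d d' (X : measurableType d) (Y : measurableType d')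
    (f : X -> Y) (A : set Y) :
  measurable_fun setT f -> measurable A -> measurable (f @^-1` A).
Proof. by move=> mf mA; rewrite -[X in measurable X]setTI; exact: mf. Qed.

Lemma measure_subset d (T : measurableType d) (R : realType)
    (mu : {measure set T -> \bar R}) (A B : set T) :
  measurable A -> measurable B -> A `<=` B -> (mu A <= mu B)%E.
Proof. by move=> mA mB AB; apply: le_measure; rewrite ?inE. Qed.

(** * Lebesgue measure on tuples *)

Definition rect (T : Type) (n : nat) (A : 'I_n -> set T) : set (n.-tuple T) :=
  [set v | forall k, A k (tnth v k)].

Definition rects d (T : measurableType d) (n : nat) : set (set (n.-tuple T)) :=
  [set rect A | A in [set A : 'I_n -> set T | forall k, measurable (A k)]].
Arguments rects {d} T n.

Lemma measurable_rect d (T : measurableType d) (n : nat) (A : 'I_n -> set T) :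
  (forall k, measurable (A k)) -> measurable (rect A).
Proof.
move=> mA; rewrite (_ : rect A = \bigcap_(k in setT) (@tnth n T ^~ k @^-1` A k)).
  apply: fin_bigcap_measurable; first exact: finite_finset.
  by move=> k _; apply: measurable_preimage => //; exact: measurable_tnth.
by apply/seteqP; split => v; [move=> Av k _; exact: Av | move=> Av k; exact: Av].
Qed.

Lemma rects_setI_closed d (T : measurableType d) (n : nat) :
  setI_closed (rects T n).
Proof.
move=> _ _ [A mA <-] [B mB <-]; exists (fun k => A k `&` B k).
  by move=> k; exact: measurableI.
apply/seteqP; split => v; first by move=> ABv; split => k; have [] := ABv k.
by move=> [Av Bv] k; split.
Qed.

(** A constraint on one coordinate is a rectangle with [setT] in the other coordinates. Together
    with stability under intersection, this makes rectangles a class on which [measure_unique] can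
    test equality of measures. *)
Lemma measurable_tuple_rects d (T : measurableType d) (n : nat) :
  @measurable _ (n.-tuple T) = <<s rects T n >>.
Proof.
apply/seteqP; split; last first.
  apply: smallest_sub; first exact: sigma_algebra_measurable.
  by move=> _ [A mA <-]; exact: measurable_rect.
apply: smallest_sub; first exact: smallest_sigma_algebra.
rewrite -bigcup_seq => B [k _ [A mA <-]]; rewrite setTI.
apply: sub_sigma_algebra; exists (fun j => if j == k then A else setT).
  by move=> j; case: ifP.
apply/seteqP; split => v /=; first by move=> /(_ k); rewrite eqxx.
by move=> Av j; case: eqP => [->|].
Qed.

(** Change of variables for a measure [nu] that is only known to agree with the image measure on
    measurable sets, so that the two structures need not be identified. *)
Lemma ge0_integral_image d d' (X : measurableType d) (Y : measurableType d')
    (R : realType) (mu : {measure set X -> \bar R}) (nu : {measure set Y -> \bar R})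
    (phi : X -> Y) (D : set Y) (f : Y -> \bar R) :
  measurable_fun setT phi ->
  (forall B, measurable B -> mu (phi @^-1` B) = nu B) ->
  measurable D -> measurable_fun D f -> (forall y, D y -> 0 <= f y)%E ->
  (\int[nu]_(y in D) f y = \int[mu]_(x in phi @^-1` D) f (phi x))%E.
Proof.
move=> mphi muE mD mf f0; pose mphim := isMeasurableFun.Build _ _ _ _ _ mphi.
pose phi' : {mfun _ >-> _} := HB.pack phi mphim.
transitivity (\int[pushforward mu phi']_(y in D) f y)%E.
  by apply: eq_measure_integral => B mB _; rewrite -muE.
by rewrite ge0_integral_pushforward// => y /set_mem; exact: f0.
Qed.

(* [lebesgue_measure] lives on a [g_sigma_algebraType] whose display differs from
   that of [R]: the measures are convertible but the integrals are not, so that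
   they have to be transferred explicitly ([ge0_integral_leb]). *)
Definition leb (R : realType) : set R -> \bar R := @lebesgue_measure R.
Arguments leb R : clear implicits.

Section LebesgueCopy.
Variable R : realType.

Let leb0 : leb R set0 = 0%E.
Proof. exact: measure0. Qed.

Let leb_ge0 A : (0 <= leb R A)%E.
Proof. exact: measure_ge0. Qed.

Let leb_semi_sigma_additive : @semi_sigma_additive _ R _ (leb R).
Proof. exact: (@measure_semi_sigma_additive _ _ _ (@lebesgue_measure R)). Qed.

HB.instance Definition _ :=
  isMeasure.Build _ R _ (leb R) leb0 leb_ge0 leb_semi_sigma_additive.

Let leb_sigma_finite : sigma_finite [set: R] (leb R).
Proof. exact: (sigma_finiteT (@lebesgue_measure R)). Qed.

HB.instance Definition _ :=
  @Measure_isSigmaFinite.Build _ R _ (leb R) leb_sigma_finite.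

End LebesgueCopy.

Lemma ge0_integral_leb (R : realType) (D : set R) (f : R -> \bar R) :
  measurable D -> measurable_fun D f -> (forall x, D x -> 0 <= f x)%E ->
  (\int[lebesgue_measure]_(x in D) f x = \int[leb R]_(x in D) f x)%E.
Proof.
move=> mD mf f0; apply/esym.
apply: (@ge0_integral_image _ _ _ _ _ (@lebesgue_measure R) (leb R) idfun) => //.
by move=> _ Y mY; rewrite setTI.
Qed.

Section TupleLebesgue.
Context {R : realType}.
Local Notation lambda := (leb R).

Lemma tuple_lebesgue_rect (n : nat) (A : 'I_n -> set R) :
  (forall k, measurable (A k)) ->
  tuple_lebesgue R n (rect A) = (\prod_(k < n) lambda (A k))%E.
Proof.
elim: n A => [|n IHn] A mA /=.
  by rewrite big_ord0 diracE mem_set// => -[].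
rewrite /tcons_measure /pushforward.
rewrite (_ : _ @^-1` _ = rect (fun k : 'I_n => A (lift ord0 k)) `*` A ord0); last first.
  apply/seteqP; split => -[w x] /=.
    move=> Awx; split => [k|]; last by have := Awx ord0; rewrite tnth0.
    by have := Awx (lift ord0 k); rewrite tnthS.
  move=> [Aw Ax] k; case: (unliftP ord0 k) => [j ->|->].
    by rewrite tnthS; exact: Aw.
  by rewrite tnth0.
pose A' (k : 'I_n) := A (lift ord0 k).
transitivity (tuple_lebesgue R n (rect A') * lambda (A ord0))%E.
  apply: (product_measure1E (tuple_lebesgue R n) (@lebesgue_measure R)).
    by apply: measurable_rect => k; exact: mA.
  exact: mA.
by rewrite IHn; [rewrite muleC big_ord_recl | move=> k; exact: mA].
Qed.

(** A name to which the sigma-finiteness of [tuple_lebesgue] can be attached, as product measures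
    and Tonelli's theorem demand it. *)
Definition tleb (n : nat) : set (n.-tuple R) -> \bar R := tuple_lebesgue R n.

HB.instance Definition _ n := Measure.on (@tleb n).

Let box (n i : nat) : set (n.-tuple R) := rect (fun=> `[- i%:R, i%:R]%classic).

Let rects_box n i : rects _ n (@box n i).
Proof. by exists (fun=> `[- i%:R, i%:R]%classic). Qed.

Let bigcup_box n : \bigcup_i @box n i = setT.
Proof.
apply/seteqP; split => // v _.
pose M := \big[Order.max/0]_(k < n) `|tnth v k|.
exists (Num.truncn M).+1 => // k /=.
have vM : `|tnth v k| <= M by apply: le_bigmax.
have : `|tnth v k| <= (Num.truncn M).+1%:R.
  by apply: (le_trans vM); apply: ltW; exact: truncnS_gt.
by rewrite ler_norml in_itv/=.
Qed.

Let tleb_box n i : (tleb (@box n i) < +oo)%E.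
Proof.
rewrite /tleb/= tuple_lebesgue_rect// ltey_eq prode_fin_num// => k _.
by rewrite /leb lebesgue_measure_itv/=; case: ifPn.
Qed.

Let sigma_finite_tleb n : sigma_finite setT (@tleb n).
Proof.
exists (@box n); first by rewrite bigcup_box.
move=> i; split; last exact: tleb_box.
by apply: measurable_rect.
Qed.

HB.instance Definition _ n :=
  @Measure_isSigmaFinite.Build _ _ _ (@tleb n) (@sigma_finite_tleb n).

Lemma measurable_join (n : nat) (k : 'I_n) :
  measurable_fun setT (fun p : R * n.-1.-tuple R => join k p.1 p.2).
Proof.
apply/measurable_fun_tnthP => j; case: (unliftP k j) => [l ->|->].
  rewrite (_ : _ \o _ = (@tnth n.-1 R ^~ l) \o snd).
    by apply: measurableT_comp => //; exact: measurable_tnth.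
  by apply/funext => p /=; rewrite tnth_mktuple liftK.
rewrite (_ : _ \o _ = fst)//.
by apply/funext => p /=; rewrite tnth_mktuple unlift_none.
Qed.

Lemma tnth_join (T : Type) (n : nat) (k : 'I_n) (x : T) w : tnth (join k x w) k = x.
Proof. by rewrite tnth_mktuple unlift_none. Qed.

Lemma tnth_join_lift (T : Type) (n : nat) (k : 'I_n) (x : T) w j :
  tnth (join k x w) (lift k j) = tnth w j.
Proof. by rewrite tnth_mktuple liftK. Qed.

Lemma joinK (T : Type) (n : nat) (k : 'I_n) (x : T) w : others k (join k x w) = w.
Proof. by apply: eq_from_tnth => j; rewrite tnth_mktuple tnth_join_lift. Qed.

Lemma othersK (T : Type) (n : nat) (k : 'I_n) (v : n.-tuple T) :
  join k (tnth v k) (others k v) = v.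
Proof.
apply: eq_from_tnth => j; case: (unliftP k j) => [l ->|->].
  by rewrite tnth_join_lift tnth_mktuple.
by rewrite tnth_join.
Qed.

Lemma measurable_others (n : nat) (k : 'I_n) :
  measurable_fun setT (@others R n k).
Proof.
apply/measurable_fun_tnthP => j.
rewrite (_ : _ \o _ = @tnth n R ^~ (lift k j)); first exact: measurable_tnth.
by apply/funext => v /=; rewrite tnth_mktuple.
Qed.

Lemma measurable_split (n : nat) (k : 'I_n) :
  measurable_fun setT (fun v : n.-tuple R => (tnth v k, others k v)).
Proof.
by apply: measurable_fun_pair; [exact: measurable_tnth | exact: measurable_others].
Qed.

(** The recursive definition of the measure only splits off the head. Agreement on rectangles makes
    all coordinates interchangeable, so that any k-th entry can be integrated separately. *)
Lemma pushforward_join (n : nat) (k : 'I_n) (B : set (n.-tuple R)) :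
  measurable B ->
  pushforward (lambda \x @tleb n.-1)%E (fun p => join k p.1 p.2) B = tleb B.
Proof.
move=> mB; pose mj := isMeasurableFun.Build _ _ _ _ _ (measurable_join k).
pose j : {mfun _ >-> _} := HB.pack (fun p : R * n.-1.-tuple R => join k p.1 p.2) mj.
apply/esym; apply: (measure_unique (rects R n) (@box n)
  (measurable_tuple_rects _ _) (@rects_setI_closed _ _ _) (rects_box n)
  (bigcup_box n) (@tleb n) (pushforward (lambda \x @tleb n.-1)%E j)) => //; last exact: tleb_box.
move=> _ [A mA <-]; rewrite [LHS]tuple_lebesgue_rect//.
transitivity ((lambda \x @tleb n.-1)%E (A k `*` rect (fun j => A (lift k j)))).
  rewrite product_measure1E//; last exact: measurable_rect.
  by rewrite [X in _ = (_ * X)%E]tuple_lebesgue_rect// (bigD1_ord k).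
rewrite /pushforward; congr ((_ \x _)%E _); apply/esym.
apply/seteqP; split => -[x w] /=.
  move=> Awx; split => [|l]; first by have := Awx k; rewrite tnth_join.
  by have := Awx (lift k l); rewrite tnth_join_lift.
move=> [Aw Ax] i; case: (unliftP k i) => [l ->|->].
  by rewrite tnth_join_lift; exact: Ax.
by rewrite tnth_join.
Qed.

(** The shape of the events on which [is_belief] tests a belief: own valuation in A, the others'
    valuations in B. *)
Definition slab (n : nat) (k : 'I_n) (A : set R) (B : set (n.-1.-tuple R)) :
  set (n.-tuple R) := [set v | A (tnth v k) /\ B (others k v)].

Lemma measurable_slab (n : nat) (k : 'I_n) A B :
  measurable A -> measurable B -> measurable (slab k A B).
Proof.
move=> mA mB.
exact: (measurable_preimage (measurable_split k) (measurableX mA mB)).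
Qed.

Lemma slab_join (n : nat) (k : 'I_n) A B x w :
  slab k A B (join k x w) = (A x /\ B w).
Proof. by rewrite /slab/= tnth_join joinK. Qed.

Lemma integral_slab (n : nat) (k : 'I_n) (A : set R) (B : set (n.-1.-tuple R))
    (f : n.-tuple R -> \bar R) :
  measurable A -> measurable B -> measurable_fun (slab k A B) f ->
  (forall v, slab k A B v -> 0 <= f v)%E ->
  (\int[tleb (n:=n)]_(v in slab k A B) f v =
   \int[lambda]_(x in A) \int[tleb (n:=n.-1)]_(w in B) f (join k x w))%E.
Proof.
move=> mA mB mf f0.
have mj := measurable_join k.
have mD := measurable_slab k mA mB.
rewrite integral_mkcond.
have mfD : measurable_fun setT (f \_ (slab k A B)) by apply/(measurable_restrictT _ _).1.
have fD0 v : (0 <= (f \_ (slab k A B)) v)%E.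
  by rewrite patchE; case: ifPn => // /set_mem /f0.
rewrite (ge0_integral_image (mu := (lambda \x @tleb n.-1)%E) mj) => //; last first.
  by move=> C mC; exact: (pushforward_join k mC).
rewrite preimage_setT fubini_tonelli1//; last exact: measurableT_comp mfD mj.
rewrite [RHS]integral_mkcond; apply: eq_integral => x _.
rewrite /fubini_F patchE; case: ifPn => [/set_mem Ax|Ax].
  rewrite [RHS]integral_mkcond; apply: eq_integral => w _ /=.
  rewrite !patchE; congr (if _ then _ else _).
  by apply/idP/idP => /set_mem; rewrite ?slab_join => Bw; apply/mem_set; rewrite ?slab_join//; case: Bw.
apply: integral0_eq => w _ /=; rewrite patchE memNset// slab_join => -[xA _].
by move: Ax; rewrite mem_set.
Qed.

(** Splitting and joining are mutually inverse and preserve measure, so null sets transfer both ways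
    between vectors and pairs (v_k, v_{-k}). *)
Lemma negligible_split (n : nat) (k : 'I_n) (P : R -> n.-1.-tuple R -> Prop) :
  {ae (lambda \x @tleb n.-1)%E, forall p, P p.1 p.2} <->
  {ae @tleb n, forall v, P (tnth v k) (others k v)}.
Proof.
split=> -[N [mN N0 subN]].
- exists ((fun v => (tnth v k, others k v)) @^-1` N); split.
  + exact: (measurable_preimage (measurable_split k)).
  + rewrite -(pushforward_join k); last first.
      exact: (measurable_preimage (measurable_split k)).
    rewrite -N0 /pushforward; congr ((_ \x _)%E _).
    by apply/seteqP; split => -[x w] /=; rewrite tnth_join joinK.
  + by move=> v /= NP; apply: subN.
- exists ((fun p => join k p.1 p.2) @^-1` N); split.
  + exact: (measurable_preimage (measurable_join k)).
  + by rewrite -N0 -(pushforward_join k).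
  + by move=> [x w] /= NP; apply: subN => /=; rewrite tnth_join joinK.
Qed.

End TupleLebesgue.
Arguments tleb R n : clear implicits.

(** * Measures with a density, null sets of products *)

Section Density.
Context d (T : measurableType d) (R : realType) (mu : {measure set T -> \bar R}).
Variables (f : T -> \bar R) (mf : measurable_fun setT f) (f0 : forall x, (0 <= f x)%E).

Definition density_measure of measurable_fun setT f & (forall x, 0 <= f x)%E :
  set T -> \bar R := fun A => (\int[mu]_(x in A) f x)%E.

Local Notation nu := (density_measure mf f0).

Let nu0 : nu set0 = 0%E.
Proof. by rewrite /density_measure integral_set0. Qed.

Let nu_ge0 A : (0 <= nu A)%E.
Proof. by apply: integral_ge0 => x _. Qed.

Let nu_semi_sigma_additive : semi_sigma_additive nu.
Proof. by apply: semi_sigma_additive_nng_induced. Qed.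

HB.instance Definition _ :=
  isMeasure.Build _ T _ nu nu0 nu_ge0 nu_semi_sigma_additive.

End Density.

Lemma ge0_integral_image_on d d' (X : measurableType d) (Y : measurableType d')
    (R : realType) (mu : {measure set X -> \bar R}) (nu : {measure set Y -> \bar R})
    (E : set X) (phi : X -> Y) (D : set Y) (f : Y -> \bar R) :
  measurable E -> measurable_fun setT phi ->
  measurable D -> (forall B, measurable B -> B `<=` D -> mu (E `&` phi @^-1` B) = nu B) ->
  measurable_fun D f -> (forall y, D y -> 0 <= f y)%E ->
  (\int[nu]_(y in D) f y = \int[mu]_(x in E `&` phi @^-1` D) f (phi x))%E.
Proof.
move=> mE mphi mD muE mf f0; pose mphim := isMeasurableFun.Build _ _ _ _ _ mphi.
pose phi' : {mfun _ >-> _} := HB.pack phi mphim.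
have mphiD : measurable (phi @^-1` D) by exact: measurable_preimage.
have mfphi : measurable_fun (phi @^-1` D) (f \o phi).
  apply: (measurable_comp (F := D)) => //; last exact: measurable_funTS.
  by move=> _ [x Dx <-].
transitivity (\int[pushforward (mrestr mu mE) phi']_(y in D) f y)%E.
  by apply: eq_measure_integral => B mB BD; rewrite -muE// setIC.
rewrite ge0_integral_pushforward//; last by move=> y /set_mem; exact: f0.
(* The restricted measure [mrestr mu mE] gives no mass to the complement of E, which can therefore
   be removed from the domain. *)
rewrite (@ge0_negligible_integral _ _ _ _ _ (~` E))//; last 3 first.
- exact: measurableC.
- by move=> x /f0.
- by rewrite /= /mrestr setICl measure0.
rewrite setDE setCK setIC; apply: eq_measure_integral => A mA.
by rewrite subsetI => -[AE _]; rewrite /= /mrestr setIidl.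
Qed.

Lemma integral_density d (T : measurableType d) (R : realType)
    (mu : {sigma_finite_measure set T -> \bar R}) (f : T -> R)
    (mf : measurable_fun setT (EFin \o f)) (f0 : forall x, (0 <= (EFin \o f) x)%E)
    (D : set T) (g : T -> \bar R) :
  measurable D -> measurable_fun D g -> (forall x, D x -> 0 <= g x)%E ->
  (\int[density_measure mu mf f0]_(x in D) g x = \int[mu]_(x in D) (g x * (f x)%:E))%E.
Proof.
move=> mD mg g0.
(* layer cake: [f mu] is the image under [fst] of the measure of the region
   below the graph of [f] *)
have mf' : measurable_fun setT f by exact/measurable_EFinP.
pose S := [set p : T * R | 0 <= p.2 /\ p.2 < f p.1].
have mS : measurable S.
  rewrite (_ : S = [set p | (0 <= p.2) && (p.2 < f p.1)]); last first.
    by apply/seteqP; split => p /= => [[-> ->]|/andP[]].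
  have mS1 : measurable_fun setT (fun p : T * R => (0 <= p.2) && (p.2 < f p.1)).
    apply: measurable_and; first exact: measurable_fun_ler.
    by apply: measurable_fun_ltr => //; exact: measurableT_comp.
  exact: (measurable_preimage mS1 (A := [set true])).
have sectionS x : xsection S x = `[0, f x[%classic.
  apply/seteqP; split => y; first by move=> /xsectionP[/= y0 yf]; rewrite /= in_itv/= y0.
  by rewrite /= in_itv/= => /andP[y0 yf]; exact/xsectionP.
have legf x : leb R `[0, f x[%classic = (f x)%:E.
  rewrite /leb lebesgue_measure_itv/= lte_fin; case: ifPn => fx.
    by rewrite sube0.
  by congr EFin; apply/eqP; rewrite eq_le -[_ <= f x]lee_fin f0 leNgt fx.
rewrite (@ge0_integral_image_on _ _ _ _ _ (mu \x leb R)%E _ S fst)//; last first.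
  move=> B mB BD; rewrite /= /product_measure1/= /density_measure.
  rewrite [RHS]integral_mkcond; apply: eq_integral => x _ /=.
  rewrite patchE; case: ifPn => [/set_mem Bx|Bx].
    rewrite [RHS]/= -legf -sectionS; congr (leb R _).
    apply/seteqP; split => y; first by move=> /xsectionP[Sy _]; exact/xsectionP.
    by move=> /xsectionP Sy; exact/xsectionP.
  rewrite -[RHS](measure0 (leb R)); congr (leb R _).
  apply/seteqP; split => // y /xsectionP[_ /= Bx'].
  by move: Bx; rewrite mem_set.
have mD1 : measurable (S `&` fst @^-1` D).
  by apply: measurableI => //; exact: measurable_preimage.
have mgD : measurable_fun (S `&` fst @^-1` D) (g \o fst).
  apply: (measurable_comp (F := D)) => //; last exact: measurable_funTS.
  by move=> _ [p [_ Dp] <-].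
rewrite integral_mkcond fubini_tonelli1//; last 2 first.
- exact: (measurable_restrictT _ mD1).1.
- by move=> p; rewrite erestrict_ge0// => q [_ /g0].
rewrite [RHS]integral_mkcond; apply: eq_integral => x _.
rewrite /fubini_F patchE; case: ifPn => [/set_mem Dx|Dx].
  rewrite -legf -integral_cst//.
  rewrite [RHS]integral_mkcond; apply: eq_integral => y _.
  rewrite -sectionS !patchE; congr (if _ then _ else _).
  by apply/idP/idP => /set_mem Sxy; apply/mem_set; [apply/xsectionP; case: Sxy |
    move/xsectionP in Sxy].
apply: integral0_eq => y _; rewrite patchE memNset//= => -[_ Dx'].
by move: Dx; rewrite mem_set.
Qed.

Section ProductNull.
Context d1 d2 (X : measurableType d1) (Y : measurableType d2) (R : realType).
Variables (m1 : {sigma_finite_measure set X -> \bar R})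
  (m2 : {sigma_finite_measure set Y -> \bar R}).

Lemma ae_xsection (P : X -> Y -> Prop) :
  {ae (m1 \x m2)%E, forall p, P p.1 p.2} -> {ae m1, forall x, {ae m2, forall y, P x y}}.
Proof.
move=> [N [mN N0 subN]].
have mNs := measurable_fun_xsection m2 mN.
have : (\int[m1]_x `|(m2 \o xsection N) x| = 0)%E.
  rewrite -N0; apply: eq_integral => x _; rewrite gee0_abs//.
move/(ae_eq_integral_abs m1 measurableT mNs) => ae0.
apply: filterS ae0 => x /= /(_ Logic.I) Nx0.
exists (xsection N x); split => //; first exact: measurable_xsection.
by move=> y NPxy; rewrite /xsection/= inE; exact: subN.
Qed.

Lemma ae_fst (P : X -> Prop) : {ae m1, forall x, P x} -> {ae (m1 \x m2)%E, forall p, P p.1}.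
Proof.
move=> [N [mN N0 subN]]; exists (N `*` setT); split; first exact: measurableX.
  by rewrite product_measure1E// [X in (X * _)%E]N0 mul0e.
by move=> p /= NP; split => //; exact: subN.
Qed.

Lemma ae_snd (P : Y -> Prop) : {ae m2, forall x, P x} -> {ae (m1 \x m2)%E, forall p, P p.2}.
Proof.
move=> [N [mN N0 subN]]; exists (setT `*` N); split; first exact: measurableX.
  by rewrite product_measure1E// [X in (_ * X)%E]N0 mule0.
by move=> p /= NP; split => //; exact: subN.
Qed.

(** Beliefs are characterized by integrals over rectangles. Finiteness of the total mass lets
    equality spread from rectangles to all measurable sets, and then the two densities coincide
    almost everywhere. *)
Lemma ae_eq_rectangles (A0 : set X) (B0 : set Y) (f g : X * Y -> R) :
  measurable A0 -> measurable B0 ->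
  measurable_fun (A0 `*` B0) f -> measurable_fun (A0 `*` B0) g ->
  (forall p, (A0 `*` B0) p -> 0 <= f p) -> (forall p, (A0 `*` B0) p -> 0 <= g p) ->
  (\int[m1 \x m2]_(p in A0 `*` B0) (f p)%:E < +oo)%E ->
  (forall A B, measurable A -> measurable B -> A `<=` A0 -> B `<=` B0 ->
    (\int[m1 \x m2]_(p in A `*` B) (f p)%:E = \int[m1 \x m2]_(p in A `*` B) (g p)%:E)%E) ->
  {ae (m1 \x m2)%E, forall p, (A0 `*` B0) p -> f p = g p}.
Proof.
move=> mA0 mB0 mf mg f0 g0 fi fg.
have mD := measurableX mA0 mB0.
pose f' := (EFin \o f) \_ (A0 `*` B0); pose g' := (EFin \o g) \_ (A0 `*` B0).
have mf' : measurable_fun setT f'.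
  by apply/(measurable_restrictT _ _).1 => //; exact/measurable_EFinP.
have mg' : measurable_fun setT g'.
  by apply/(measurable_restrictT _ _).1 => //; exact/measurable_EFinP.
have f'0 p : (0 <= f' p)%E by rewrite erestrict_ge0// => q /f0; rewrite lee_fin.
have g'0 p : (0 <= g' p)%E by rewrite erestrict_ge0// => q /g0; rewrite lee_fin.
have f'E C : (\int[m1 \x m2]_(p in C) f' p =
    \int[m1 \x m2]_(p in C `&` (A0 `*` B0)) (f p)%:E)%E by rewrite integral_mkcondr.
have g'E C : (\int[m1 \x m2]_(p in C) g' p =
    \int[m1 \x m2]_(p in C `&` (A0 `*` B0)) (g p)%:E)%E by rewrite integral_mkcondr.
have H C : measurable C -> density_measure (m1 \x m2)%E mf' f'0 C =
    density_measure (m1 \x m2)%E mg' g'0 C.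
  apply: (measure_unique [set A `*` B | A in measurable & B in measurable] (fun=> setT)) => //.
  - exact: measurable_prod_measurableType.
  - move=> _ _ [A1 mA1 [B1 mB1 <-]] [A2 mA2 [B2 mB2 <-]].
    exists (A1 `&` A2); first exact: measurableI.
    by exists (B1 `&` B2); [exact: measurableI | rewrite setXI].
  - by move=> _; exists setT => //; exists setT => //; rewrite setXTT.
  - by rewrite bigcup_const.
  - move=> _ [A mA [B mB <-]]; rewrite /= /density_measure f'E g'E -setXI.
    by apply: fg => //; exact: measurableI.
  - by move=> _; rewrite /= /density_measure f'E setTI.
have : ae_eq (m1 \x m2)%E (A0 `*` B0) (EFin \o f) (EFin \o g).
  apply: integral_ae_eq => //.
  - apply/integrableP; split; first exact/measurable_EFinP.
    rewrite (eq_integral (EFin \o f))// => p /set_mem /f0 fp.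
    by rewrite gee0_abs//= lee_fin.
  - exact/measurable_EFinP.
  - move=> C CD mC; have := H C mC.
    by rewrite /density_measure f'E g'E !setIidl.
by apply: filterS => p fgp Dp; have [] := fgp Dp.
Qed.

End ProductNull.

(** * Predictors and the admission probability *)

(** As with [leb], a copy of the measure on [R] with its usual structure; [psiE] carries the
    integral over. *)
Definition lsm (R : realType) (F : predictor R) (k : nat) : set R -> \bar R :=
  lebesgue_stieltjes_measure (signal_cdf_pow F k).

Section LebesgueStieltjesCopy.
Variables (R : realType) (F : predictor R) (k : nat).

Let ls := lebesgue_stieltjes_measure (signal_cdf_pow F k).

Let lsm0 : lsm F k set0 = 0%E.
Proof. exact: (measure0 ls). Qed.

Let lsm_ge0 A : (0 <= lsm F k A)%E.
Proof. exact: (measure_ge0 ls). Qed.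

Let lsm_semi_sigma_additive : @semi_sigma_additive _ R _ (lsm F k).
Proof. exact: (@measure_semi_sigma_additive _ _ _ ls). Qed.

HB.instance Definition _ :=
  isMeasure.Build _ R _ (lsm F k) lsm0 lsm_ge0 lsm_semi_sigma_additive.

Let lsm_sigma_finite : sigma_finite [set: R] (lsm F k).
Proof. exact: (sigma_finiteT ls). Qed.

HB.instance Definition _ :=
  @Measure_isSigmaFinite.Build _ R _ (lsm F k) lsm_sigma_finite.

Let lsm_itv a b : lsm F k `]a, b]%classic = wlength (signal_cdf_pow F k) `]a, b]%classic.
Proof.
rewrite /lsm /lebesgue_stieltjes_measure /measure_extension/=.
by rewrite measurable_mu_extE/=; last exact: is_ocitv.
Qed.

(** A distribution function determines its measure, because differences of half-lines are the
    intervals []a, b]] that generate. This is how the law of the best rejected signal is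
    recognized. *)
Lemma lsm_unique (nu : {measure set R -> \bar R}) (A : set R) :
  (forall x, nu `]-oo, x]%classic = (signal_cdf_pow F k x)%:E) ->
  measurable A -> lsm F k A = nu A.
Proof.
move=> nuE mA; apply: (measure_unique (@ocitv R)
  (fun n => `](- n%:R), n%:R]%classic)) => //.
- exact: ocitvI.
- by move=> i; exact: is_ocitv.
- apply/seteqP; split => // x _; exists (Num.truncn `|x|).+1 => //=.
  have : `|x| < (Num.truncn `|x|).+1%:R by exact: truncnS_gt.
  by rewrite in_itv/= ltr_norml => /andP[-> /ltW].
- move=> I [[a b]]/= _ <-; rewrite [LHS]lsm_itv.
  have [ab | ba] := leP a b; last first.
    by rewrite set_itv_ge ?wlength0 ?measure0// bnd_simp -leNgt ltW.
  rewrite wlength_itv_bnd//.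
  have -> : `]a, b]%classic = `]-oo, b] `\` `]-oo, a].
    by rewrite -[RHS]setCK setCD setCitvl setUC -[LHS]setCK setCitv.
  rewrite measureD//; last by rewrite [X in (X < _)%E]nuE ltry.
  by rewrite setIidr; [rewrite EFinB -!nuE | exact: subset_itvl].
- move=> i; rewrite [X in (X < _)%E]lsm_itv wlength_itv_bnd ?ltry//.
  by apply: (le_trans (y := 0)); rewrite ?oppr_le0.
Qed.

End LebesgueStieltjesCopy.

Lemma measurable_unit (R : realType) : measurable (unit_itv R).
Proof. exact: (measurable_itv `[0, 1]). Qed.
#[global] Hint Extern 0 (measurable (unit_itv _)) => solve [exact: measurable_unit] : core.

Lemma measurable_cube (R : realType) (n : nat) : measurable (cube R n).
Proof.
apply: (@measurable_rect _ R n (fun=> unit_itv R)) => k; exact: measurable_unit.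
Qed.
#[global] Hint Extern 0 (measurable (cube _ _)) => solve [exact: measurable_cube] : core.

Section Predictor.
Variables (R : realType) (F : predictor R).
Local Notation K := (signal_kernel F).

Let kernel_fin_num v A : measurable A -> K v A \is a fin_num.
Proof.
move=> mA; rewrite ge0_fin_numE//; apply: (@le_lt_trans _ _ (K v setT)).
  by apply: le_measure; rewrite ?inE.
by rewrite prob_kernel ltry.
Qed.

Lemma cond_signal_cdfE x v : (cond_signal_cdf F x v)%:E = K v `]-oo, x]%classic.
Proof. by rewrite fineK//; exact: kernel_fin_num. Qed.

Lemma cond_signal_cdfC x v : (1 - cond_signal_cdf F x v)%:E = K v `]x, +oo[%classic.
Proof.
rewrite EFinB cond_signal_cdfE -(prob_kernel (s := K) v) -(setUv `]-oo, x]%classic).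
rewrite measureU//; [|exact: measurableC|exact: setICr].
rewrite addeAC subee ?add0e ?setCitvl//.
exact: kernel_fin_num.
Qed.

Lemma cond_signal_cdf_ge0 x v : 0 <= cond_signal_cdf F x v.
Proof. by rewrite -lee_fin cond_signal_cdfE. Qed.

Lemma cond_signal_cdfC_ge0 x v : 0 <= 1 - cond_signal_cdf F x v.
Proof. by rewrite -lee_fin cond_signal_cdfC. Qed.

Lemma cond_signal_cdfC_le1 x v : 1 - cond_signal_cdf F x v <= 1.
Proof. by rewrite gerBl cond_signal_cdf_ge0. Qed.

Let ksnd (p : R * R) : {measure set R -> \bar R} := K p.2.

Let measurable_ksnd U : measurable U -> measurable_fun setT (ksnd ^~ U).
Proof. by move=> mU; exact: (measurableT_comp (measurable_kernel K U mU)). Qed.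

HB.instance Definition _ := isKernel.Build _ _ _ _ _ ksnd measurable_ksnd.

Let ksnd_uub : measure_fam_uub ksnd.
Proof. by exists 2%R => p; rewrite /ksnd prob_kernel lte_fin ltr1n. Qed.

HB.instance Definition _ := Kernel_isFinite.Build _ _ _ _ _ ksnd ksnd_uub.

(** Joint measurability in (x, v), which Tonelli's theorem needs later. The value is the mass that
    the kernel (x, v) |-> K(v) gives to the section y <= x of a measurable set; [ksnd] adds the
    parameter x to the kernel. *)
Lemma measurable_cond_signal_cdf :
  measurable_fun setT (fun p : R * R => cond_signal_cdf F p.1 p.2).
Proof.
pose A := [set q : (R * R) * R | q.2 <= q.1.1].
have mA : measurable A.
  have mle : measurable_fun setT (fun q : (R * R) * R => q.2 <= q.1.1).
    by apply: measurable_fun_ler => //; exact: measurableT_comp.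
  exact: (measurable_preimage mle (A := [set true])).
have := @measurable_fun_xsection_finite_kernel _ _ _ _ R ksnd A (mem_set mA).
move=> /(measurableT_comp (@fine_measurable R setT measurableT)).
apply: eq_measurable_fun => p _ /=; rewrite /cond_signal_cdf; congr (fine (K p.2 _)).
apply/seteqP; split => y; first by move=> /xsectionP Ay; rewrite /= in_itv.
by rewrite /= in_itv/= => yx; exact/xsectionP.
Qed.

Lemma law_signal_null (B : set R) : measurable B -> leb R (B `&` unit_itv R) = 0%E ->
  law F (setT `*` B) = 0%E.
Proof.
move=> mB B0; rewrite f2_density//.
have mBu : measurable (B `&` unit_itv R) by apply: measurableI.
have mf2 : measurable_fun (B `&` unit_itv R) (f2 F).
  by apply: (measurable_funS _ _ (measurable_f2 F)) => //; exact: subIsetr.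
have f20 s : (B `&` unit_itv R) s -> (0 <= (f2 F s)%:E)%E.
  by move=> [_ us]; rewrite lee_fin ltW// f2_gt0.
rewrite ge0_integral_leb//; last exact/measurable_EFinP.
by apply: null_set_integral => //; exact/measurable_EFinP.
Qed.

Lemma law_null (A B : set R) : measurable A -> measurable B ->
  leb R (B `&` unit_itv R) = 0%E -> law F (A `*` B) = 0%E.
Proof.
move=> mA mB B0; apply/eqP; rewrite -measure_le0 -(law_signal_null mB B0).
apply: le_measure; rewrite ?inE; first exact: measurableX.
  exact: measurableX.
by move=> p [].
Qed.

Lemma leb_set1 (x : R) : leb R [set x] = 0%E.
Proof. exact: lebesgue_measure_set1. Qed.

Lemma law_set1 (A : set R) (x : R) : measurable A -> law F (A `*` [set x]) = 0%E.
Proof.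
move=> mA; apply: law_null => //; apply: (subset_measure0 _ _ _ (leb_set1 x)).
- by apply: measurableI => //; exact: measurable_set1.
- exact: measurable_set1.
- exact: subIsetl.
Qed.

Lemma measurable_f1_sub (A : set R) : measurable A -> A `<=` unit_itv R ->
  measurable_fun A (f1 F).
Proof. by move=> mA Au; apply: measurable_funS (measurable_f1 F). Qed.

Lemma law_kernelE (A B : set R) : measurable A -> measurable B ->
  law F (A `*` B) =
  (\int[leb R]_(v in A `&` unit_itv R) (K v B * (f1 F v)%:E))%E.
Proof.
move=> mA mB; rewrite signal_kernelE// ge0_integral_leb//.
- exact: measurableI.
- apply: emeasurable_funM.
    by apply: measurable_funTS; exact: measurable_kernel.
  apply/measurable_EFinP; apply: measurable_f1_sub; last exact: subIsetr.
  exact: measurableI.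
- by move=> v [_ uv]; rewrite mule_ge0// lee_fin ltW// f1_gt0.
Qed.

(** Admission asks for signals at least x, whereas psi contains the probability of exceeding x
    strictly. The kernel at an individual v might charge the point x, but the law does not, since
    signals have a density. *)
Lemma law_ccdf (A : set R) (x : R) : measurable A ->
  law F (A `*` `[x, +oo[%classic) =
  (\int[leb R]_(v in A `&` unit_itv R) ((1 - cond_signal_cdf F x v) * f1 F v)%:E)%E.
Proof.
move=> mA; transitivity (law F (A `*` `]x, +oo[%classic)).
  have -> : A `*` `[x, +oo[%classic = (A `*` [set x]) `|` (A `*` `]x, +oo[%classic).
    rewrite -(@setU1itv _ _ _ x false)//; apply/seteqP; split => -[v s] /=.
      by move=> [Av [->|xs]]; [left|right].
    by move=> [[Av ->]|[Av xs]]; split=> //; [left|right].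
  rewrite measureU//; last 3 first.
  - exact: measurableX.
  - exact: measurableX.
  - by apply/seteqP; split => // -[v s] [[_ /= ->] [_]] /=; rewrite in_itv/= ltxx.
  by rewrite [X in (X + _)%E](_ : _ = 0%E); [rewrite add0e | exact: law_set1].
rewrite law_kernelE//; apply: eq_integral => v _.
by rewrite -cond_signal_cdfC EFinM.
Qed.

(** The integral of F_{2|1}(0 | v) f_1(v) is the probability that the signal is at most 0, which is
    null, and f_1 is positive. This supplies the hypothesis of [psi_gt0] for almost every v. *)
Lemma kernel_le0_ae :
  {ae leb R, forall v, unit_itv R v -> cond_signal_cdf F 0 v = 0}.
Proof.
have mc : measurable_fun (unit_itv R) (fun v => cond_signal_cdf F 0 v * f1 F v).
  apply: measurable_funM; last exact: measurable_f1.
  apply: measurable_funTS.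
  exact: (measurableT_comp measurable_cond_signal_cdf (measurable_fun_pair _ _)).
have : (\int[leb R]_(v in unit_itv R) `|(cond_signal_cdf F 0 v * f1 F v)%:E| = 0)%E.
  have <- : law F (setT `*` `]-oo, 0]%classic) = 0%E.
    apply: law_null => //; apply: (subset_measure0 _ _ _ (leb_set1 0)).
    - exact: measurableI.
    - exact: measurable_set1.
    by move=> x [/=]; rewrite /unit_itv/= !in_itv/= => x0 /andP[x0' _]; apply/eqP; rewrite eq_le x0.
  rewrite law_kernelE// setTI; apply: eq_integral => v /set_mem uv.
  rewrite -cond_signal_cdfE -EFinM gee0_abs// lee_fin mulr_ge0 ?cond_signal_cdf_ge0//.
  by rewrite ltW// f1_gt0.
move/(ae_eq_integral_abs (leb R) (@measurable_unit R) ((measurable_EFinP _ _).2 mc)).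
apply: filterS => v /[swap] uv /(_ uv) [] /eqP; rewrite mulf_eq0 => /orP[/eqP//|].
by rewrite gt_eqF// f1_gt0.
Qed.

End Predictor.

(** * Tonelli's theorem on rectangles and product integrands *)

Section SectionIntegral.
Context d1 d2 (X : measurableType d1) (Y : measurableType d2) (R : realType).
Variables (m1 : {sigma_finite_measure set X -> \bar R})
  (m2 : {sigma_finite_measure set Y -> \bar R}).
Variables (A : set X) (B : set Y) (f : X * Y -> \bar R).
Hypotheses (mA : measurable A) (mB : measurable B).
Hypothesis mf : measurable_fun (A `*` B) f.
Hypothesis f0 : forall p, (A `*` B) p -> (0 <= f p)%E.

Let g := f \_ (A `*` B).

Let mg : measurable_fun setT g.
Proof. by apply: (measurable_restrictT _ _).1 => //; exact: measurableX. Qed.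

Let g0 p : (0 <= g p)%E.
Proof. by rewrite erestrict_ge0. Qed.

Let section_patch x :
  fubini_F m2 g x = ((fun x => \int[m2]_(y in B) f (x, y))%E \_ A) x.
Proof.
rewrite /fubini_F patchE; case: ifPn => [/set_mem Ax|Ax].
  rewrite [RHS]integral_mkcond; apply: eq_integral => y _; rewrite /g !patchE.
  by congr (if _ then _ else _); apply/idP/idP => /set_mem; rewrite ?inE//= => -[].
apply: integral0_eq => y _; rewrite /g patchE memNset// => -[Ax' _].
by move: Ax; rewrite mem_set.
Qed.

Lemma measurable_integral_section :
  measurable_fun A (fun x => \int[m2]_(y in B) f (x, y))%E.
Proof.
apply/(measurable_restrictT _ mA).
have := @measurable_fun_fubini_tonelli_F _ _ _ _ R m2 g mg g0.
by apply: eq_measurable_fun => x _; exact: section_patch.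
Qed.

Lemma integral_prodX :
  (\int[m1 \x m2]_(p in A `*` B) f p = \int[m1]_(x in A) \int[m2]_(y in B) f (x, y))%E.
Proof.
rewrite integral_mkcond fubini_tonelli1// [RHS]integral_mkcond.
by apply: eq_integral => x _; exact: section_patch.
Qed.

End SectionIntegral.

Lemma tonelli_on d1 d2 (X : measurableType d1) (Y : measurableType d2) (R : realType)
    (m1 : {sigma_finite_measure set X -> \bar R})
    (m2 : {sigma_finite_measure set Y -> \bar R})
    (A : set X) (B : set Y) (f : X * Y -> \bar R) :
  measurable A -> measurable B -> measurable_fun (A `*` B) f ->
  (forall p, (A `*` B) p -> 0 <= f p)%E ->
  (\int[m1]_(x in A) \int[m2]_(y in B) f (x, y) =
   \int[m2]_(y in B) \int[m1]_(x in A) f (x, y))%E.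
Proof.
move=> mA mB mf f0.
have mAB := measurableX mA mB.
rewrite -integral_prodX// integral_mkcond fubini_tonelli2//; last 2 first.
- exact: (measurable_restrictT _ mAB).1.
- by move=> p; rewrite erestrict_ge0.
rewrite [RHS]integral_mkcond; apply: eq_integral => y _; rewrite /fubini_G patchE.
case: ifPn => [/set_mem By|By].
  rewrite [RHS]integral_mkcond; apply: eq_integral => x _; rewrite !patchE.
  by congr (if _ then _ else _); apply/idP/idP => /set_mem; rewrite ?inE//= => -[].
apply: integral0_eq => x _; rewrite patchE memNset// => -[_ By'].
by move: By; rewrite mem_set.
Qed.

Section ProductIntegral.
Context {R : realType}.

Lemma measurable_prod_tnth (n : nat) (B : 'I_n -> set R) (phi : 'I_n -> R -> R) :
  (forall k, measurable (B k)) -> (forall k, measurable_fun (B k) (phi k)) ->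
  measurable_fun (rect B) (fun v => \prod_(k < n) phi k (tnth v k)).
Proof.
move=> mB mphi; apply: measurable_prod => k _.
apply: (measurable_comp (F := B k)) => //; last first.
  by apply: measurable_funTS; exact: measurable_tnth.
by move=> _ [v Bv <-]; exact: Bv.
Qed.

Lemma rect_slab (n : nat) (k : 'I_n) (B : 'I_n -> set R) :
  rect B = slab k (B k) (rect (fun j => B (lift k j))).
Proof.
apply/seteqP; split => v /=.
  by move=> Bv; split => [|j]; rewrite ?tnth_mktuple; exact: Bv.
move=> [Bk Bv] j; case: (unliftP k j) => [l ->|->] //.
by have := Bv l; rewrite tnth_mktuple.
Qed.

Lemma integral_rect_prod (n : nat) (B : 'I_n -> set R) (phi : 'I_n -> R -> R) :
  (forall k, measurable (B k)) -> (forall k, measurable_fun (B k) (phi k)) ->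
  (forall k x, B k x -> 0 <= phi k x) ->
  (\int[tleb R n]_(v in rect B) (\prod_(k < n) phi k (tnth v k))%:E =
   \prod_(k < n) \int[leb R]_(x in B k) (phi k x)%:E)%E.
Proof.
elim: n B phi => [|n IHn] B phi mB mphi phi0.
  (* For n = 0 the measure is the Dirac mass at the empty tuple and both sides equal 1. *)
  have -> : rect B = setT by apply/seteqP; split => // v _ [].
  transitivity (\int[@dirac _ (0.-tuple R) [tuple] R]_v (cst 1%E) v)%E.
    by apply: eq_integral => v _; rewrite big_ord0.
  by rewrite integral_dirac// diracT mul1e big_ord0.
have mB' : measurable (rect (fun k : 'I_n => B (lift ord0 k))).
  by apply: measurable_rect => k.
have mp := measurable_prod_tnth mB mphi.
rewrite (rect_slab ord0) integral_slab//; last 2 first.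
- by rewrite -rect_slab; exact/measurable_EFinP.
- move=> v; rewrite -rect_slab => Bv; rewrite lee_fin prodr_ge0// => k _.
  exact: (phi0 k _ (Bv k)).
have IH := IHn (fun k => B (lift ord0 k)) (fun k => phi (lift ord0 k)) (fun k => mB (lift ord0 k)) (fun k => mphi (lift ord0 k))
  (fun k => @phi0 (lift ord0 k)).
rewrite big_ord_recl/= -[X in (_ * X)%E]IH.
have mp' := measurable_prod_tnth (fun k => mB (lift ord0 k)) (fun k => mphi (lift ord0 k)).
rewrite -ge0_integralZr//; last 3 first.
- by apply/measurable_EFinP; exact: (mphi ord0).
- by move=> x Bx; rewrite lee_fin; exact: (phi0 ord0 _ Bx).
- by apply: integral_ge0 => w Bw; rewrite lee_fin prodr_ge0// => k _; exact: (phi0 (lift ord0 k) _ (Bw k)).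
apply: eq_integral => x /set_mem Bx.
rewrite -ge0_integralZl//; last 3 first.
- exact/measurable_EFinP.
- by move=> w Bw; rewrite lee_fin prodr_ge0// => k _; exact: (phi0 (lift ord0 k) _ (Bw k)).
- by rewrite lee_fin; exact: (phi0 ord0 _ Bx).
apply: eq_integral => w _; rewrite -EFinM big_ord_recl tnth_join; congr (_ * _)%:E.
by apply: eq_bigr => k _; rewrite tnth_join_lift.
Qed.

End ProductIntegral.

(** * Finiteness, measurability and positivity of psi *)

Section Psi.
Variables (R : realType) (m n : nat) (F : predictor R).
Local Notation c := (cond_signal_cdf F).
Local Notation mu := (lsm F (m - n)).

(** Given the valuations v, the probability that all n signals exceed x; it is the integrand of
    psi. *)
Definition survival (v : n.-tuple R) (x : R) : R := \prod_(k < n) (1 - c x (tnth v k)).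

Lemma survival_ge0 v x : 0 <= survival v x.
Proof. by apply: prodr_ge0 => k _; exact: cond_signal_cdfC_ge0. Qed.

Lemma survival_le1 v x : survival v x <= 1.
Proof.
apply: prodr_ile1 => k _.
by rewrite cond_signal_cdfC_ge0 cond_signal_cdfC_le1.
Qed.

Lemma measurable_survival : measurable_fun setT (fun p : n.-tuple R * R => survival p.1 p.2).
Proof.
apply: measurable_prod => k _; apply: measurable_funB => //.
have mg : measurable_fun setT (fun p : n.-tuple R * R => (p.2, tnth p.1 k)).
  apply: measurable_fun_pair => //.
  by apply: (measurableT_comp (measurable_tnth k)).
exact: (measurableT_comp (measurable_cond_signal_cdf F) mg).
Qed.

Lemma measurable_survival_r v : measurable_fun setT (survival v).
Proof.
have mg : measurable_fun setT (fun x : R => (v, x)) by exact: measurable_fun_pair.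
exact: (measurableT_comp measurable_survival mg).
Qed.

Lemma lsm_itv_bnd (k : nat) (a b : R) : a <= b ->
  lsm F k `]a, b]%classic = (signal_cdf F b ^+ k - signal_cdf F a ^+ k)%:E.
Proof.
move=> ab; rewrite /lsm /lebesgue_stieltjes_measure /measure_extension/=.
by rewrite measurable_mu_extE/=; [rewrite wlength_itv_bnd | exact: is_ocitv].
Qed.

Lemma lsm_unit_fin (k : nat) : (lsm F k (unit_itv R) < +oo)%E.
Proof.
(* The unit interval is enlarged to a half-open one, whose mass is an increment of the distribution
   function. *)
apply: (@le_lt_trans _ _ (lsm F k `]-1, 1]%classic)); last first.
  by rewrite lsm_itv_bnd ?ltry// lerN10.
apply: measure_subset => // x; rewrite /unit_itv/= !in_itv/= => /andP[x0 ->].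
by rewrite (lt_le_trans _ x0)// ltrN10.
Qed.

Lemma psiE (v : n.-tuple R) : (n < m)%N ->
  (psi m F v)%:E = (\int[mu]_(x in unit_itv R) (survival v x)%:E)%E.
Proof.
move=> nm; rewrite /psi nm.
have -> : (\int[lebesgue_stieltjes_measure (signal_cdf_pow F (m - n))]_(x in unit_itv R)
      (survival v x)%:E = \int[mu]_(x in unit_itv R) (survival v x)%:E)%E.
  apply/esym; apply: (@ge0_integral_image _ _ _ _ _
    (lebesgue_stieltjes_measure (signal_cdf_pow F (m - n))) mu idfun) => //.
  - by move=> _ Y mY; rewrite setTI.
  - by apply/measurable_EFinP/measurable_funTS; exact: measurable_survival_r.
  - by move=> x _; rewrite lee_fin survival_ge0.
rewrite fineK// ge0_fin_numE; last first.
  by apply: integral_ge0 => x _; rewrite lee_fin survival_ge0.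
apply: (@le_lt_trans _ _ (\int[mu]_(x in unit_itv R) 1)%E).
  apply: ge0_le_integral => //.
  - by move=> x _; rewrite lee_fin survival_ge0.
  - by apply/measurable_EFinP/measurable_funTS; exact: measurable_survival_r.
  - by move=> x _; rewrite lee_fin survival_le1.
by rewrite integral_cst// mul1e; exact: lsm_unit_fin.
Qed.

Lemma psi_ge0 (v : n.-tuple R) : 0 <= psi m F v.
Proof.
have [nm|nm] := boolP (n < m)%N; last by rewrite /psi (negbTE nm).
rewrite -lee_fin psiE//; apply: integral_ge0 => x _.
by rewrite lee_fin survival_ge0.
Qed.

Lemma measurable_psi : measurable_fun setT (fun v : n.-tuple R => psi m F v).
Proof.
have [nm|nm] := boolP (n < m)%N; last first.
  by rewrite /psi (negbTE nm); exact: measurable_cst.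
apply/measurable_EFinP.
pose f (p : n.-tuple R * R) : \bar R :=
  ((fun p => (survival p.1 p.2)%:E) \_ (setT `*` unit_itv R)) p.
have mf : measurable_fun setT f.
  apply/(measurable_restrictT _ _).1; first exact: measurableX.
  by apply/measurable_EFinP/measurable_funTS; exact: measurable_survival.
have f0 p : (0 <= f p)%E.
  by apply: erestrict_ge0 => q _; rewrite lee_fin survival_ge0.
have := @measurable_fun_fubini_tonelli_F _ _ _ _ R mu f mf f0.
apply: eq_measurable_fun => v _ /=; rewrite psiE// integral_mkcond.
apply: eq_integral => x _; rewrite /f !patchE.
by congr (if _ then _ else _); apply/idP/idP => /set_mem; rewrite ?inE//= => -[].
Qed.

Lemma psi_perm (s : {perm 'I_n}) (v : n.-tuple R) :
  psi m F [tuple tnth v (s k) | k < n] = psi m F v.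
Proof.
have H x : survival [tuple tnth v (s k) | k < n] x = survival v x.
  rewrite /survival [RHS](reindex_inj (@perm_inj _ s))/=.
  by apply: eq_bigr => k _; rewrite tnth_mktuple.
rewrite /psi; case: ifP => // _; congr fine; apply: eq_integral => x _.
by congr EFin; exact: H.
Qed.

Lemma signal_cdf_le0 (a : R) : a <= 0 -> signal_cdf F a = 0.
Proof.
move=> a0; rewrite /signal_cdf law_null//.
apply: (subset_measure0 _ _ _ (leb_set1 0)).
- exact: measurableI.
- exact: measurable_set1.
move=> x [/=]; rewrite /unit_itv/= !in_itv/= => xa /andP[x0' _].
by apply/eqP; rewrite eq_le x0' (le_trans xa).
Qed.

(** If F_2(a) were 0, then f_2 would vanish almost everywhere on [0, min(a, 1)], an interval of
    positive length on which it is positive. *)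
Lemma signal_cdf_gt0 (a : R) : 0 < a -> 0 < signal_cdf F a.
Proof.
move=> a0; rewrite lt_neqAle signal_cdf_ge0 andbT; apply/eqP => cdf0.
have mA : measurable (`]-oo, a]%classic `&` unit_itv R) by exact: measurableI.
have f20 s : (`]-oo, a]%classic `&` unit_itv R) s -> (0 <= (f2 F s)%:E)%E.
  by move=> [_ us]; rewrite lee_fin ltW// f2_gt0.
have mf2 : measurable_fun (`]-oo, a]%classic `&` unit_itv R) (EFin \o f2 F).
  apply/measurable_EFinP.
  by apply: (measurable_funS _ _ (measurable_f2 F)) => //; exact: subIsetr.
have : (\int[leb R]_(s in `]-oo, a]%classic `&` unit_itv R) `|(f2 F s)%:E| = 0)%E.
  rewrite -[RHS]/(0%:E) cdf0 /signal_cdf fineK ?fin_num_measure//; last exact: measurableX.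
  rewrite f2_density// ge0_integral_leb//; apply: eq_integral => s /set_mem us.
  by rewrite gee0_abs// f20.
move/(ae_eq_integral_abs (leb R) mA mf2) => -[N [mN N0 subN]].
have : leb R (`[0, Num.min a 1]%classic) = 0%E.
  apply: (subset_measure0 _ _ _ N0) => //.
  move=> x /=; rewrite in_itv/= le_min => /and3P[x0 xa x1]; apply: subN => /= H.
  have Ax : (`]-oo, a]%classic `&` unit_itv R) x.
    by split; rewrite /unit_itv/= in_itv//= x0.
  have := H Ax; rewrite /= => -[] f2x0.
  by have := f2_gt0 F Ax.2; rewrite f2x0 ltxx.
rewrite /leb lebesgue_measure_itv/= lte_fin lt_min a0 ltr01 sube0 => -[] /eqP.
by rewrite gt_eqF// lt_min a0 ltr01.
Qed.

(** By right continuity at 0, all the conditional distribution functions stay below 1 on some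
    interval []0, e]], so the integrand of psi is positive there, and F_2^(m-n) charges this
    interval. *)
Lemma psi_gt0 (v : n.-tuple R) : (forall k, c 0 (tnth v k) = 0) -> 0 < psi m F v.
Proof.
move=> c0; have [nm|nm] := boolP (n < m)%N; last by rewrite /psi (negbTE nm).
have cvg0 k : (c i.+1%:R^-1 (tnth v k))%:E @[i --> \oo] --> (0 : \bar R).
  have -> : 0%E = signal_kernel F (tnth v k) (\bigcap_i `]-oo, i.+1%:R^-1]%classic).
    rewrite -[LHS]/(0%:E) -(c0 k) cond_signal_cdfE; congr (signal_kernel F _ _).
    apply/seteqP; split => x /=; rewrite ?in_itv/=.
      by move=> x0 i _ /=; rewrite in_itv/= (le_trans x0)// invr_ge0.
    move=> H; rewrite leNgt; apply/negP => x0.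
    (* For x > 0 this index i satisfies [i.+1%:R^-1 < x], so x is outside the i-th half-line. *)
    have := H (Num.truncn x^-1) Logic.I; rewrite /= in_itv/= leNgt => /negP; apply.
    by rewrite invf_plt ?posrE// truncnS_gt.
  under eq_fun do rewrite cond_signal_cdfE.
  apply: nonincreasing_cvg_mu => //.
  - by rewrite -cond_signal_cdfE ltry.
  - exact: bigcap_measurable.
  - move=> i j ij; apply/subsetPset => x /=; rewrite !in_itv/= => /le_trans; apply.
    by rewrite lef_pV2 ?posrE// ler_nat.
(* There are finitely many coordinates, so one index serves them all. *)
have : \forall i \near \oo, forall k, c i.+1%:R^-1 (tnth v k) < 1.
  apply: filter_forall => k; have /fine_cvgP[_] := cvg0 k.
  by move/cvgr_lt; apply; exact: ltr01.
move=> [i _ /(_ i (leqnn i)) clt1]; set e := i.+1%:R^-1 in clt1.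
have e0 : 0 < e by rewrite invr_gt0.
have e1 : e <= 1 by rewrite invf_le1// ler1n.
rewrite lt_neqAle psi_ge0 andbT; apply/eqP => psi0.
have ms : measurable_fun (unit_itv R) (EFin \o survival v).
  by apply/measurable_EFinP/measurable_funTS; exact: measurable_survival_r.
have : (\int[mu]_(x in unit_itv R) `|(survival v x)%:E| = 0)%E.
  rewrite -[RHS]/(0%:E) psi0 psiE//; apply: eq_integral => x _.
  by rewrite gee0_abs// lee_fin survival_ge0.
move/(ae_eq_integral_abs mu (@measurable_unit R) ms) => -[N [mN N0 subN]].
have : mu `]0, e]%classic = 0%E.
  apply: (subset_measure0 _ _ _ N0) => //.
  move=> x /=; rewrite in_itv/= => /andP[x0 xe]; apply: subN => /= H.
  have : unit_itv R x by rewrite /unit_itv/= in_itv/= ltW//= (le_trans xe).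
  move/H => -[]; apply/eqP; rewrite gt_eqF//; apply: prodr_gt0 => k _.
  rewrite subr_gt0; apply: le_lt_trans (clt1 k).
  rewrite -lee_fin !cond_signal_cdfE; apply: measure_subset => // y /=.
  by rewrite !in_itv/= => /le_trans; apply.
(* The lower term [0 ^+ (m - n)] vanishes because n < m. *)
rewrite lsm_itv_bnd ?ltW// (signal_cdf_le0 (lexx 0)) expr0n subn_eq0 leqNgt nm subr0.
by move=> [] /eqP; rewrite gt_eqF// exprn_gt0// signal_cdf_gt0.
Qed.

End Psi.

(** * The law of the admitted valuations *)

(** The first side is open and the second closed because a maximum is below a, and a minimum at
    least b, when every signal is. Bounding the missing side by integers recovers each half-plane as
    a countable union of quadrants. *)
Lemma measurable_quadrants (R : realType) :
  @measurable _ (R * R)%type =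
  <<s [set A `*` B | A in @RGenInftyO.G R & B in @RGenCInfty.G R] >>.
Proof.
set G := [set _ `*` _ | _ in _ & _ in _].
apply/seteqP; split; last first.
  apply: smallest_sub; first exact: sigma_algebra_measurable.
  by move=> _ [_ [a ->] [_ [b ->] <-]]; exact: measurableX.
apply: smallest_sub; first exact: smallest_sigma_algebra.
have Gfst : measurable_fun setT (fst : g_sigma_algebraType G -> R).
  apply: (measurability (@RGenInftyO.G R)); first exact: RGenInftyO.measurableE.
  move=> _ [_ [a ->] <-]; rewrite setTI.
  have -> : fst @^-1` `]-oo, a[%classic =
      \bigcup_i (`]-oo, a[%classic `*` `[- (i%:R), +oo[%classic) :> set (R * R).
    apply/seteqP; split => -[x y] /=; last by move=> [i _ []].
    move=> xa; exists (Num.truncn `|y|).+1 => //; split => //=.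
    rewrite in_itv/= andbT lerNl; apply: ltW; apply: le_lt_trans (truncnS_gt _).
    by rewrite -normrN ler_norm.
  apply: bigcup_measurable => i _; apply: sub_sigma_algebra.
  by exists `]-oo, a[%classic; [exists a | exists `[- (i%:R), +oo[%classic => //; exists (- i%:R)].
have Gsnd : measurable_fun setT (snd : g_sigma_algebraType G -> R).
  apply: (measurability (@RGenCInfty.G R)); first exact: RGenCInfty.measurableE.
  move=> _ [_ [b ->] <-]; rewrite setTI.
  have -> : snd @^-1` `[b, +oo[%classic =
      \bigcup_i (`]-oo, i%:R[%classic `*` `[b, +oo[%classic) :> set (R * R).
    apply/seteqP; split => -[x y] /=; last by move=> [i _ []].
    move=> yb; exists (Num.truncn `|x|).+1 => //; split => //=.
    by rewrite in_itv/=; apply: le_lt_trans (truncnS_gt _); exact: ler_norm.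
  apply: bigcup_measurable => i _; apply: sub_sigma_algebra.
  by exists `]-oo, i%:R[%classic; [exists i%:R | exists `[b, +oo[%classic => //; exists b].
by move=> C [[A mA <-]|[A mA <-]]; [exact: Gfst | exact: Gsnd].
Qed.

Lemma independent_joint_law d (T : measurableType d) (R : realType)
    (P : probability T R) (X Y : {RV P >-> R}) (C : set (R * R)) :
  (forall a b, P [set t | X t < a /\ b <= Y t] =
    (P [set t | (X t < a)%R] * P [set t | (b <= Y t)%R])%E) ->
  measurable C ->
  P [set t | C (X t, Y t)] = (distribution P X \x distribution P Y)%E C.
Proof.
move=> XY mC.
have mXY : measurable_fun setT (fun t => (X t, Y t)) by exact: measurable_fun_pair.
pose XYm := isMeasurableFun.Build _ _ _ _ _ mXY.
pose XY' : {mfun T >-> (R * R)%type} := HB.pack (fun t => (X t, Y t)) XYm.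
apply/esym; apply: (measure_unique [set A `*` B | A in @RGenInftyO.G R & B in @RGenCInfty.G R]
  (fun i => `]-oo, i%:R[%classic `*` `[- (i%:R), +oo[%classic)
  (measurable_quadrants R) _ _ _ (distribution P X \x distribution P Y)%E
  (distribution P XY')) => //.
- move=> _ _ [_ [a ->] [_ [b ->] <-]] [_ [a' ->] [_ [b' ->] <-]].
  exists `]-oo, Num.min a a'[%classic; first by exists (Num.min a a').
  exists `[Num.max b b', +oo[%classic; first by exists (Num.max b b').
  apply/seteqP; split => -[x y] /=; rewrite !in_itv/= !andbT lt_min ge_max.
    by move=> [/andP[-> ->] /andP[-> ->]].
  by move=> [[-> ->] [-> ->]].
- move=> i; exists `]-oo, i%:R[%classic; first by exists i%:R.
  by exists `[- (i%:R), +oo[%classic => //; exists (- i%:R).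
- apply/seteqP; split => // -[x y] _.
  exists (Num.truncn (Num.max `|x| `|y|)).+1 => //.
  have : Num.max `|x| `|y| < (Num.truncn (Num.max `|x| `|y|)).+1%:R by exact: truncnS_gt.
  rewrite gt_max => /andP[xN yN]; split; rewrite /= in_itv/=.
    by rewrite (le_lt_trans (ler_norm x)).
  by rewrite andbT lerNl ltW// (le_lt_trans _ yN)// -normrN ler_norm.
- move=> _ [_ [a ->] [_ [b ->] <-]].
  transitivity (distribution P X `]-oo, a[%classic * distribution P Y `[b, +oo[%classic)%E.
    exact: product_measure1E.
  have -> : distribution P X `]-oo, a[%classic = P [set t | (X t < a)%R].
    by congr (P _); apply/seteqP; split => t /=; rewrite in_itv.
  have -> : distribution P Y `[b, +oo[%classic = P [set t | (b <= Y t)%R].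
    by congr (P _); apply/seteqP; split => t /=; rewrite in_itv/= andbT.
  rewrite -XY; congr (P _); apply/seteqP.
  by split => t /=; rewrite !in_itv/= andbT.
- move=> i; apply: (@le_lt_trans _ _ 1%E); last exact: ltry.
  by apply: probability_le1; exact: measurableX.
Qed.

Lemma ae_eq_measure d (T : measurableType d) (R : realType)
    (mu : {measure set T -> \bar R}) (A B : set T) :
  measurable A -> measurable B -> {ae mu, forall t, A t <-> B t} -> mu A = mu B.
Proof.
move=> mA mB [N [mN N0 subN]].
have H C : measurable C -> mu C = mu (C `\` N).
  move=> mC; rewrite (measureDI mu mC mN) [X in (_ + X)%E](_ : _ = 0%E) ?adde0//.
  by apply: (subset_measure0 _ mN _ N0) => //; exact: measurableI.
rewrite (H A)// (H B)//; congr (mu _); apply/seteqP; split => t [Ct Nt]; split => //.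
  by apply: contrapT => Bt; apply: Nt; apply: (subN t) => -[AB _]; exact: (Bt (AB Ct)).
by apply: contrapT => At; apply: Nt; apply: (subN t) => -[_ BA]; exact: (At (BA Ct)).
Qed.

Section Bidder.
Variables (m n : nat) (I : nset m n).

Lemma bidder_inj : injective (bidder I).
Proof. by move=> j k /enum_val_inj /cast_ord_inj. Qed.

Lemma bidderP k : bidder I k \in val I.
Proof. exact: enum_valP. Qed.

Lemma bidder_surj i : i \in val I -> exists k, bidder I k = i.
Proof.
move=> iI; exists (cast_ord (eqP (valP I)) (enum_rank_in iI i)).
by rewrite /bidder cast_ordK enum_rankK_in.
Qed.

Lemma big_bidder (T : Type) (idx : T) (op : Monoid.com_law idx) (G : 'I_m -> T) :
  \big[op/idx]_(i in val I) G i = \big[op/idx]_(k < n) G (bidder I k).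
Proof.
rewrite big_enum_val (reindex (cast_ord (esym (eqP (valP I)))))//.
by apply: onW_bij; exists (cast_ord (eqP (valP I))); [exact: cast_ordKV|exact: cast_ordK].
Qed.

(** Constraints on positions become constraints on bidders, the indexing that [pairs_independent]
    uses. *)
Definition spread (T : Type) (A : 'I_n -> set T) (i : 'I_m) : set T :=
  if [pick k | bidder I k == i] is Some k then A k else setT.

Lemma spread_bidder (T : Type) (A : 'I_n -> set T) k : spread A (bidder I k) = A k.
Proof.
rewrite /spread; case: pickP => [j /eqP /bidder_inj -> //|/(_ k)].
by rewrite eqxx.
Qed.

Lemma measurable_spread d (T : measurableType d) (A : 'I_n -> set T) i :
  (forall k, measurable (A k)) -> measurable (spread A i).
Proof. by move=> mA; rewrite /spread; case: pickP. Qed.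

End Bidder.

(** * Independence across groups of bidders and absence of ties *)

Section Model.
Variables (R : realType) (m n : nat) (F : predictor R).
Variables (d : measure_display) (T : measurableType d) (P : probability T R).
Variables (V S : 'I_m -> {RV P >-> R}) (adm : T -> nset m n).
Hypothesis Hmodel : prescreening F V S adm.

Definition pairs_in (J : {set 'I_m}) (E : 'I_m -> set (R * R)) : set T :=
  [set t | forall i, i \in J -> E i (V i t, S i t)].

Lemma measurable_pair_preimage i (E : set (R * R)) :
  measurable E -> measurable [set t | E (V i t, S i t)].
Proof.
move=> mE; apply: (measurable_preimage (f := fun t => (V i t, S i t))) => //.
exact: measurable_fun_pair.
Qed.

Lemma measurable_pairs_in J E : (forall i, measurable (E i)) -> measurable (pairs_in J E).
Proof.
move=> mE; rewrite (_ : pairs_in J E =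
    \bigcap_(i in [set i | i \in J]) [set t | E i (V i t, S i t)]).
  apply: fin_bigcap_measurable; first exact: finite_finset.
  by move=> i _; exact: measurable_pair_preimage.
by apply/seteqP; split => t Et i; exact: Et.
Qed.

Lemma prob_pairs_in J E : (forall i, measurable (E i)) ->
  P (pairs_in J E) = (\prod_(i in J) law F (E i))%E.
Proof.
move=> mE; rewrite /pairs_in (pairs_independent Hmodel)//.
by apply: eq_bigr => i _; rewrite (pair_law Hmodel).
Qed.

(** Merging the two families into a single one on all bidders reduces the independence of
    complementary groups to the product formula. *)
Lemma prob_pairs_inI J E E' : (forall i, measurable (E i)) -> (forall i, measurable (E' i)) ->
  P (pairs_in J E `&` pairs_in (~: J) E') = (P (pairs_in J E) * P (pairs_in (~: J) E'))%E.
Proof.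
move=> mE mE'; rewrite (_ : pairs_in J E `&` pairs_in (~: J)%SET E' =
    pairs_in [set: 'I_m]%SET (fun i => if i \in J then E i else E' i)).
  rewrite !prob_pairs_in//; last by move=> i; case: ifP.
  rewrite (bigID (mem J))/=; congr (_ * _)%E.
    by apply: eq_big => [i|i /andP[_ ->]] //; rewrite inE.
  by apply: eq_big => [i|i /andP[_ /negbTE ->]] //; rewrite !inE.
apply/seteqP; split => t /=.
  move=> [EJ EJ'] i _; case: ifP => iJ; first exact: EJ.
  by apply: EJ'; rewrite inE iJ.
move=> H; split => i; first by move=> iJ; have := H i; rewrite iJ inE; apply.
by rewrite inE => /negbTE iJ; have := H i; rewrite iJ inE; apply.
Qed.

Lemma ae_signal_unit : {ae P, forall t, forall i, unit_itv R (S i t)}.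
Proof.
apply: filter_forall => i.
exists [set t | (setT `*` ~` unit_itv R) (V i t, S i t)]; split.
- by apply: measurable_pair_preimage; apply: measurableX => //; exact: measurableC.
- rewrite (pair_law Hmodel); last by apply: measurableX => //; exact: measurableC.
  by apply: law_null => //; [exact: measurableC | rewrite setICl measure0].
- by move=> t /= St; split.
Qed.

(** Two signals are independent and every single value is null for the second one, so the diagonal
    is null for their joint law. *)
Lemma ae_signal_no_tie : {ae P, forall t, forall i j, i != j -> S i t != S j t}.
Proof.
apply: filter_forall => i; apply: filter_forall => j.
have [->|ij] := eqVneq i j; first by apply: nearW.
have mD : measurable [set p : R * R | p.1 == p.2].
  have mD : measurable_fun setT (fun p : R * R => p.1 == p.2) by exact: measurable_fun_eqr.
  exact: (measurable_preimage mD (A := [set true])).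
exists [set t | [set p : R * R | p.1 == p.2] (S i t, S j t)]; split.
- apply: (measurable_preimage (f := fun t => (S i t, S j t))) => //.
  exact: measurable_fun_pair.
- rewrite independent_joint_law//.
    apply: integral0_eq => x _ /=.
    have -> : xsection [set p : R * R | p.1 == p.2] x = [set x].
      apply/seteqP; split => y; first by move=> /xsectionP /= /eqP ->.
      by move=> ->; apply/xsectionP => /=.
    rewrite /distribution/= /pushforward.
    have -> : S j @^-1` [set x] = [set t | (setT `*` [set x]) (V j t, S j t)].
      by apply/seteqP; split => t /=; [move=> ->|case].
    by rewrite (pair_law Hmodel) ?law_set1//; apply: measurableX => //; exact: measurable_set1.
  (* The family writes S_i < a and b <= S_j as one event on the pair of bidders; its values at i and
     j are the ones that count. *)
  move=> a b; pose E k : set (R * R) :=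
    if k == i then setT `*` `]-oo, a[%classic else setT `*` `[b, +oo[%classic.
  have mE k : measurable (E k) by rewrite /E; case: ifP => _; exact: measurableX.
  have := pairs_independent Hmodel [set i; j]%SET mE.
  rewrite big_setU1 ?inE//= big_set1 => H.
  have Ei : [set t | E i (V i t, S i t)] = [set t | S i t < a].
    by rewrite /E eqxx; apply/seteqP; split => t /=; rewrite in_itv/=; [case|].
  have Ej : [set t | E j (V j t, S j t)] = [set t | b <= S j t].
    rewrite /E eq_sym (negbTE ij); apply/seteqP; split => t /=; rewrite in_itv/= andbT.
      by case.
    by [].
  rewrite -Ei -Ej -H; congr (P _); apply/seteqP; split => t /=.
    move=> [Eit Ejt] k; rewrite !inE => /orP[/eqP ->|/eqP ->].
      by have : [set t | S i t < a] t := Eit; rewrite -Ei.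
    by have : [set t | b <= S j t] t := Ejt; rewrite -Ej.
  move=> H'; split.
    suff : [set t | S i t < a] t by [].
    by rewrite -Ei; apply: H'; rewrite !inE eqxx.
  suff : [set t | b <= S j t] t by [].
  by rewrite -Ej; apply: H'; rewrite !inE eqxx orbT.
- by move=> t /= H; apply: contrapT => Sij; apply: H => _; exact/negP.
Qed.

End Model.

Section Admission.
Variables (R : realType) (m n : nat) (F : predictor R).
Variables (d : measure_display) (T : measurableType d) (P : probability T R).
Variables (V S : 'I_m -> {RV P >-> R}) (adm : T -> nset m n).
Hypothesis Hmodel : prescreening F V S adm.

(** The default 0 is the bottom of the signal range, so it almost surely leaves the maximum of a
    nonempty family unchanged. *)
Definition best_rejected (J : {set 'I_m}) (t : T) : R :=
  \big[Order.max/0]_(j | j \notin J) S j t.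

(* The value [-1], below every [best_rejected], encodes the failure of the
   constraint on the admitted valuations, so that a single comparison of two
   independent random variables expresses the whole event. *)
Definition worst_admitted (J : {set 'I_m}) (B : 'I_m -> set R) (t : T) : R :=
  if `[< pairs_in V S J (fun i => B i `*` `[0, +oo[%classic) t >]
  then \big[Order.min/1]_(i in J) S i t else -1.

Lemma best_rejected_ltE J a : [set t | best_rejected J t < a] =
  if 0 < a then pairs_in V S (~: J) (fun=> setT `*` `]-oo, a[%classic) else set0.
Proof.
apply/seteqP; split => t /=.
  move=> /bigmax_ltP[-> Sa] i; rewrite inE => iJ; split => //=.
  by rewrite in_itv/= Sa.
case: ifPn => // a0 H; apply/bigmax_ltP; split => // i iJ.
by have /(_ _) [|_] := H i; rewrite ?inE//= in_itv.
Qed.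

Lemma best_rejected_leE J a : [set t | best_rejected J t <= a] =
  if 0 <= a then pairs_in V S (~: J) (fun=> setT `*` `]-oo, a]%classic) else set0.
Proof.
apply/seteqP; split => t /=.
  move=> /bigmax_leP[-> Sa] i; rewrite inE => iJ; split => //=.
  by rewrite in_itv/= Sa.
case: ifPn => // a0 H; apply/bigmax_leP; split => // i iJ.
by have /(_ _) [|_] := H i; rewrite ?inE//= in_itv.
Qed.

(** The thresholds reflect the defaults: the value is never below -1, the minimum is capped at 1,
    and in between the failure value is excluded. The requirement S_i >= 0 merges with b <= S_i into
    [Num.max b 0]. *)
Lemma worst_admitted_geE J B b : [set t | b <= worst_admitted J B t] =
  if b <= -1 then setT
  else if b <= 1 then pairs_in V S J (fun i => B i `*` `[Num.max b 0, +oo[%classic)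
  else set0.
Proof.
have [b1|b1] := leP b (-1).
  apply/seteqP; split => // t _ /=; rewrite /worst_admitted.
  case: asboolP => // H; rewrite (le_trans b1)//; apply/bigmin_geP; split.
    by rewrite (@le_trans _ _ 0)// oppr_le0.
  move=> i iJ; have [_ /=] := H i iJ; rewrite in_itv/= andbT.
  by apply: le_trans; rewrite oppr_le0.
apply/seteqP; split => t /=; rewrite /worst_admitted.
  case: asboolP => [H /bigmin_geP[-> bS] i iJ|_]; last by rewrite leNgt b1.
  have [Bi] := H i iJ; rewrite /= !in_itv/= !andbT => Si; split => //.
  by rewrite ge_max Si bS.
case: ifPn => // b1' H; case: asboolP => [_|[]].
  apply/bigmin_geP; split => // i iJ; have [_] := H i iJ.
  by rewrite /= in_itv/= andbT ge_max => /andP[].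
move=> i iJ; have [Bi] := H i iJ.
by rewrite /= in_itv/= andbT ge_max => /andP[_ Si]; split => //=; rewrite in_itv/= Si.
Qed.

Let measurable_lt J a : measurable [set t | best_rejected J t < a].
Proof.
rewrite best_rejected_ltE; case: ifP => // _.
by apply: measurable_pairs_in => i; exact: measurableX.
Qed.

Let measurable_ge J B b : (forall i, measurable (B i)) ->
  measurable [set t | b <= worst_admitted J B t].
Proof.
move=> mB; rewrite worst_admitted_geE; case: ifP => // _; case: ifP => // _.
by apply: measurable_pairs_in => i; exact: measurableX.
Qed.

Lemma measurable_best_rejected J : measurable_fun setT (best_rejected J).
Proof.
apply: (measurability (@RGenInftyO.G R)); first exact: RGenInftyO.measurableE.
move=> _ [_ [a ->] <-]; rewrite setTI; rewrite [X in measurable X](_ : _ =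
  [set t | best_rejected J t < a]); first exact: measurable_lt.
by apply/seteqP; split => t /=; rewrite in_itv.
Qed.

Lemma measurable_worst_admitted J B : (forall i, measurable (B i)) ->
  measurable_fun setT (worst_admitted J B).
Proof.
move=> mB; apply: (measurability (@RGenCInfty.G R)); first exact: RGenCInfty.measurableE.
move=> _ [_ [b ->] <-]; rewrite setTI; rewrite [X in measurable X](_ : _ =
  [set t | b <= worst_admitted J B t]); first exact: measurable_ge.
by apply/seteqP; split => t /=; rewrite in_itv/= andbT.
Qed.

(** The first variable involves only bidders outside J, the second only those in J. *)
Let best_worst_independent J B a b : (forall i, measurable (B i)) ->
  P [set t | best_rejected J t < a /\ b <= worst_admitted J B t] =
  (P [set t | (best_rejected J t < a)%R] * P [set t | (b <= worst_admitted J B t)%R])%E.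
Proof.
move=> mB.
rewrite [X in P X](_ : _ = [set t | best_rejected J t < a] `&`
  [set t | b <= worst_admitted J B t])//.
rewrite best_rejected_ltE worst_admitted_geE.
case: ifP => _; last by rewrite set0I measure0 mul0e.
case: ifP => _; first by rewrite setIT probability_setT mule1.
case: ifP => _; last by rewrite setI0 measure0 mule0.
rewrite setIC muleC (prob_pairs_inI Hmodel)//.
- by move=> i; exact: measurableX.
- by move=> i; exact: measurableX.
Qed.

Let lsm_best_rejected J (k : nat) (A : set R) : #|~: J| = k -> (0 < k)%N ->
  measurable A -> lsm F k A = P (best_rejected J @^-1` A).
Proof.
move=> cJ k0 mA; have mM := measurable_best_rejected J.
pose Mm := isMeasurableFun.Build _ _ _ _ _ mM.
pose M : {mfun T >-> R} := HB.pack (best_rejected J) Mm.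
apply: (@lsm_unique R F k (distribution P M)) => // x.
transitivity (P [set t | best_rejected J t <= x]).
  by congr (P _); apply/seteqP; split => t /=; rewrite in_itv.
rewrite best_rejected_leE /signal_cdf_pow; case: ifPn => [x0|]; last first.
  (* For x < 0 the maximum cannot be at most x because of its default 0, and the k-th power of
     F_2(x) = 0 vanishes as k > 0. *)
  by rewrite -ltNge => x0; rewrite measure0 signal_cdf_le0 ?ltW// expr0n gtn_eqF.
rewrite (prob_pairs_in Hmodel); last by move=> i; exact: measurableX.
have -> : law F (setT `*` `]-oo, x]%classic) = (signal_cdf F x)%:E.
  by rewrite fineK//; apply: fin_num_measure; exact: measurableX.
by rewrite prodEFin prodr_const cJ.
Qed.

Lemma prob_best_le_worst J B (k : nat) : #|~: J| = k -> (0 < k)%N ->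
  (forall i, measurable (B i)) ->
  P [set t | best_rejected J t <= worst_admitted J B t] =
  (\int[lsm F k]_(x in unit_itv R)
    P (pairs_in V S J (fun i => B i `*` `[x, +oo[%classic)))%E.
Proof.
move=> cJ k0 mB.
pose Mm := isMeasurableFun.Build _ _ _ _ _ (measurable_best_rejected J).
pose M : {mfun T >-> R} := HB.pack (best_rejected J) Mm.
pose Zm := isMeasurableFun.Build _ _ _ _ _ (measurable_worst_admitted J mB).
pose Z : {mfun T >-> R} := HB.pack (worst_admitted J B) Zm.
pose C := [set p : R * R | p.1 <= p.2].
have mC : measurable C.
  have mle : measurable_fun setT (fun p : R * R => p.1 <= p.2).
    exact: measurable_fun_ler.
  exact: (measurable_preimage mle (A := [set true])).
have -> := @independent_joint_law _ _ _ P M Z C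
  (fun a b => best_worst_independent J a b mB) mC.
have mphi := measurable_fun_xsection (distribution P Z) mC.
transitivity (\int[lsm F k]_x (distribution P Z) (xsection C x))%E.
  by apply: eq_measure_integral => A mA _; exact/esym/(lsm_best_rejected cJ k0 mA).
(* All signals lie in [0, 1] almost surely, hence so does the best rejected one, and the integral
   may be restricted. *)
have mU : measurable (~` unit_itv R) by exact: measurableC.
rewrite (@ge0_negligible_integral _ _ _ (lsm F k) setT (~` unit_itv R))//; last first.
  rewrite [LHS](lsm_best_rejected cJ)//.
  have mS1 : measurable (best_rejected J @^-1` (~` unit_itv R)).
    by apply: measurable_preimage => //; exact: measurable_best_rejected.
  rewrite -(measure0 P); apply: ae_eq_measure => //.
  apply: filterS (ae_signal_unit Hmodel) => t uS; split => //; apply.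
  rewrite /unit_itv/= in_itv/=; apply/andP; split.
    by apply/bigmax_geP; left.
  apply/bigmax_leP; split => // j _.
  by have := uS j; rewrite /unit_itv/= in_itv/= => /andP[].
rewrite setDE setCK setTI; apply: eq_integral => x /set_mem.
rewrite /unit_itv/= in_itv/= => /andP[x0 x1].
have -> : distribution P Z (xsection C x) = P [set t | x <= worst_admitted J B t].
  congr (P _); apply/seteqP.
  by split => t; [move=> /xsectionP | move=> xZ; apply/xsectionP].
(* For 0 <= x <= 1 only the middle case remains, and [Num.max x 0] is x. *)
rewrite worst_admitted_geE x1 max_l// ifF//.
by apply/negbTE; rewrite -ltNge (lt_le_trans _ x0)// oppr_lt0.
Qed.

Lemma ae_admittedP (I : nset m n) (A : 'I_n -> set R) : {ae P, forall t,
  (best_rejected (val I) t <= worst_admitted (val I) (spread I A) t) <->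
  (adm @^-1` [set I] `&` admitted_valuations V I @^-1` rect A) t}.
Proof.
apply: filterS2 (ae_signal_unit Hmodel) (ae_signal_no_tie Hmodel) => t uS tieS.
have S0 i : 0 <= S i t by have := uS i; rewrite /unit_itv/= in_itv/= => /andP[].
have S1 i : S i t <= 1 by have := uS i; rewrite /unit_itv/= in_itv/= => /andP[].
have M0 : 0 <= best_rejected (val I) t by apply/bigmax_geP; left.
split; last first.
  move=> [/= admI VA]; rewrite /worst_admitted; case: asboolP => [_|[]].
    apply/bigmin_geP; split; first by apply/bigmax_leP.
    move=> i iI; apply/bigmax_leP; split => // j jI.
    by apply: (adm_top Hmodel); rewrite admI.
  move=> i /bidder_surj[k <-]; rewrite spread_bidder; split => /=.
    by have := VA k; rewrite tnth_mktuple.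
  by rewrite in_itv/= S0.
rewrite /worst_admitted; case: asboolP => [H MZ|_]; last first.
  by move=> /(le_trans M0); rewrite leNgt oppr_lt0 ltr01.
have SS i j : i \in val I -> j \notin val I -> S j t <= S i t.
  move=> iI jI; have /bigmin_geP[_ /(_ i iI)] := MZ.
  by move=> /bigmax_leP[_]; apply.
split; last first.
  move=> k /=; rewrite tnth_mktuple; have := H _ (bidderP I k).
  by rewrite spread_bidder => -[].
apply/val_inj/eqP => /=; rewrite eqEcard (eqP (valP I)) (eqP (valP (adm t))) leqnn andbT.
apply/negPn/negP => /subsetPn[j jadm jI].
have : ~~ (val I \subset val (adm t)).
  apply/negP => sIadm; have : val I == val (adm t).
    by rewrite eqEcard sIadm (eqP (valP I)) (eqP (valP (adm t))) leqnn.
  by move=> /eqP Iadm; move: jI; rewrite Iadm jadm.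
move=> /subsetPn[i iI iadm].
have ij : i != j by apply: contraNneq iadm => ->.
have := tieS _ _ ij; rewrite eq_le => /negP; apply; apply/andP; split.
  exact: (adm_top Hmodel).
exact: SS.
Qed.

Lemma measurable_admitted (I : nset m n) : measurable_fun setT (admitted_valuations V I).
Proof.
apply/measurable_fun_tnthP => k.
rewrite (_ : _ \o _ = V (bidder I k))//.
by apply/funext => t /=; rewrite tnth_mktuple.
Qed.

Lemma measurable_admission (I : nset m n) (A : 'I_n -> set R) : (forall k, measurable (A k)) ->
  measurable (adm @^-1` [set I] `&` admitted_valuations V I @^-1` rect A).
Proof.
move=> mA; apply: measurableI; first exact: (measurable_adm Hmodel).
by apply: measurable_preimage; [exact: measurable_admitted|exact: measurable_rect].
Qed.

Definition weight (v : n.-tuple R) : R := psi m F v * \prod_(k < n) f1 F (tnth v k).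

Lemma rect_cube (A : 'I_n -> set R) :
  rect A `&` cube R n = rect (fun k => A k `&` unit_itv R).
Proof.
by apply/seteqP; split => v; [move=> [Av cv] k; split|move=> H; split => k; have [] := H k].
Qed.

Lemma prob_admission_rect (I : nset m n) (A : 'I_n -> set R) : (forall k, measurable (A k)) ->
  P (adm @^-1` [set I] `&` admitted_valuations V I @^-1` rect A) =
  (\int[tleb R n]_(v in rect A `&` cube R n) (weight v)%:E)%E.
Proof.
move=> mA; have mB i : measurable (spread I A i) by exact: measurable_spread.
have mAu k : measurable (A k `&` unit_itv R) by exact: measurableI.
have f1ge0 k x : (A k `&` unit_itv R) x -> 0 <= f1 F x.
  by move=> [_ ux]; rewrite ltW// f1_gt0.
have mf1 k : measurable_fun (A k `&` unit_itv R) (f1 F).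
  by apply: measurable_f1_sub => //; exact: subIsetr.
rewrite rect_cube.
(* If n = m, nobody is rejected and psi is 1 by definition; the probability is then a product of
   valuation laws. *)
have [nm|nm] := boolP (n < m)%N; last first.
  have En : #|'I_m| = n.
    rewrite card_ord; apply/eqP; rewrite eqn_leq leqNgt nm /=.
    by rewrite -(eqP (valP I)) -[leqRHS]card_ord max_card.
  have all_in (J : nset m n) i : i \in val J.
    have : val J = [set: 'I_m]%SET.
      by apply/eqP; rewrite eqEcard finset.subsetT cardsT En (eqP (valP J)) leqnn.
    by move=> ->; rewrite inE.
  rewrite [X in P X](_ : _ = pairs_in V S (val I) (fun i => spread I A i `*` setT)).
    rewrite (prob_pairs_in Hmodel); last by move=> i; exact: measurableX.
    rewrite big_bidder.
    transitivity (\prod_(k < n) \int[leb R]_(x in A k `&` unit_itv R) (f1 F x)%:E)%E.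
      apply: eq_bigr => k _; rewrite spread_bidder f1_density// ge0_integral_leb//.
        exact/measurable_EFinP.
      by move=> x /f1ge0; rewrite lee_fin.
    rewrite -integral_rect_prod//; apply: eq_integral => v _.
    by rewrite /weight /psi (negbTE nm) mul1r.
  apply/seteqP; split => t /=.
    move=> [_ VA] i /bidder_surj[k <-]; rewrite spread_bidder; split => //=.
    by have := VA k; rewrite tnth_mktuple.
  move=> H; split; last first.
    by move=> k; rewrite tnth_mktuple; have := H _ (bidderP I k); rewrite spread_bidder => -[].
  by apply/val_inj/setP => i; rewrite !all_in.
have mEV := measurable_admission I mA.
have mU : measurable [set t | best_rejected (val I) t <= worst_admitted (val I) (spread I A) t].
  have mle : measurable_fun setT (fun t => best_rejected (val I) t <= worst_admitted (val I) (spread I A) t).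
    by apply: measurable_fun_ler; [exact: measurable_best_rejected|exact: measurable_worst_admitted].
  exact: (measurable_preimage mle (A := [set true])).
rewrite -(ae_eq_measure mU mEV (ae_admittedP I A)).
have cI : #|~: val I| = (m - n)%N.
  by rewrite cardsCs finset.setCK card_ord (eqP (valP I)).
have mn0 : (0 < m - n)%N by rewrite subn_gt0.
apply: (etrans (prob_best_le_worst cI mn0 mB)).
pose h (x : R) (v : n.-tuple R) := survival F v x * \prod_(k < n) f1 F (tnth v k).
have mprod := measurable_prod_tnth mAu mf1.
have prod_ge0 v : rect (fun k => A k `&` unit_itv R) v -> 0 <= \prod_(k < n) f1 F (tnth v k).
  by move=> Av; apply: prodr_ge0 => k _; exact: (f1ge0 k _ (Av k)).
have mrect := measurable_rect mAu.
(* For fixed x the bidders in I are independent, so the probability is a product of one-dimensional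
   integrals, that is, one integral over the rectangle. Exchanging the two integrals then leaves psi
   inside. *)
transitivity (\int[lsm F (m - n)]_(x in unit_itv R)
    \int[tleb R n]_(v in rect (fun k => A k `&` unit_itv R)) (h x v)%:E)%E.
  apply: eq_integral => x _.
  rewrite (prob_pairs_in Hmodel); last by move=> i; exact: measurableX.
  rewrite big_bidder.
  transitivity (\prod_(k < n) \int[leb R]_(v in A k `&` unit_itv R)
      ((1 - cond_signal_cdf F x v) * f1 F v)%:E)%E.
    by apply: eq_bigr => k _; rewrite spread_bidder law_ccdf.
  rewrite -(@integral_rect_prod _ _ _ (fun _ v => (1 - cond_signal_cdf F x v) * f1 F v))//.
  - apply: eq_integral => v _; rewrite /h /survival -big_split/=.
    by congr EFin; apply: eq_bigr => k _.
  - move=> k; apply: measurable_funM => //; apply: measurable_funTS.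
    apply: measurable_funB => //.
    have mg : measurable_fun setT (fun v : R => (x, v)) by exact: measurable_fun_pair.
    exact: (measurableT_comp (measurable_cond_signal_cdf F) mg).
  - by move=> k v Av; rewrite mulr_ge0 ?cond_signal_cdfC_ge0// (f1ge0 k).
rewrite (@tonelli_on _ _ _ _ _ (lsm F (m - n)) (tleb R n) _ _ (fun p => (h p.1 p.2)%:E))//; last 2 first.
- apply/measurable_EFinP; apply: measurable_funM.
    apply: measurable_funTS.
    have mg : measurable_fun setT (fun p : R * n.-tuple R => (p.2, p.1)).
      exact: measurable_fun_pair.
    exact: (measurableT_comp (measurable_survival F) mg).
  have msnd : measurable_fun (unit_itv R `*` rect (fun k => A k `&` unit_itv R))
      (snd : R * n.-tuple R -> n.-tuple R) by exact: measurable_funTS.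
  by apply: (measurable_comp mrect _ mprod msnd) => _ [p [_ Ap] <-].
- by move=> p [_ Ap]; rewrite lee_fin mulr_ge0 ?survival_ge0// prod_ge0.
apply: eq_integral => v /set_mem Av; rewrite /weight /h/= EFinM psiE//.
under eq_integral do rewrite EFinM.
rewrite ge0_integralZr//.
- by apply/measurable_EFinP/measurable_funTS; exact: measurable_survival_r.
- by move=> x _; rewrite lee_fin survival_ge0.
- by rewrite lee_fin prod_ge0.
Qed.

End Admission.

Lemma muleI_EFin (R : realType) (p : R) (x y : \bar R) :
  p != 0 -> (p%:E * x = p%:E * y)%E -> x = y.
Proof.
move=> p0 /(congr1 (fun z => (p^-1)%:E * z)%E).
by rewrite !muleA -EFinM mulVf// !mul1e.
Qed.

Section AdmissionLaw.
Variables (R : realType) (m n : nat) (F : predictor R).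
Variables (d : measure_display) (T : measurableType d) (P : probability T R).
Variables (V S : 'I_m -> {RV P >-> R}) (adm : T -> nset m n).
Hypothesis Hmodel : prescreening F V S adm.
Local Notation weight := (@weight R m n F).

Lemma weight_ge0 v : cube R n v -> 0 <= weight v.
Proof.
move=> cv; rewrite mulr_ge0 ?psi_ge0// prodr_ge0// => k _.
by rewrite ltW// f1_gt0.
Qed.

Lemma measurable_prod_f1 (p : nat) :
  measurable_fun (cube R p) (fun v => \prod_(k < p) f1 F (tnth v k)).
Proof.
apply: (@measurable_prod_tnth R p (fun=> unit_itv R) (fun=> f1 F)) => k.
  exact: measurable_unit.
exact: measurable_f1.
Qed.

Lemma measurable_weight : measurable_fun (cube R n) weight.
Proof.
apply: measurable_funM; last exact: measurable_prod_f1.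
by apply: measurable_funTS; exact: measurable_psi.
Qed.

Lemma prob_admission (I : nset m n) (B : set (n.-tuple R)) : measurable B ->
  P (adm @^-1` [set I] `&` admitted_valuations V I @^-1` B) =
  (\int[tleb R n]_(v in B `&` cube R n) (weight v)%:E)%E.
Proof.
move=> mB; have mE := measurable_adm Hmodel I.
pose VIm := isMeasurableFun.Build _ _ _ _ _ (measurable_admitted V I).
pose VI : {mfun T >-> n.-tuple R} := HB.pack (admitted_valuations V I) VIm.
pose w := weight \_ (cube R n).
have mw : measurable_fun setT (EFin \o w).
  by apply/measurable_EFinP; apply/(measurable_restrictT _ _).1 => //; exact: measurable_weight.
have w0 v : (0 <= (EFin \o w) v)%E.
  by rewrite lee_fin /w patchE; case: ifPn => // /set_mem; exact: weight_ge0.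
have wE B' : (\int[tleb R n]_(v in B') (EFin \o w) v =
    \int[tleb R n]_(v in B' `&` cube R n) (weight v)%:E)%E.
  rewrite integral_mkcondr; apply: eq_integral => v _.
  by rewrite /= /w !patchE; case: ifP.
rewrite -wE.
transitivity (pushforward (mrestr P mE) VI B).
  by rewrite /pushforward /mrestr setIC.
apply: (measure_unique (rects R n) (fun=> setT) (measurable_tuple_rects _ _)
  (@rects_setI_closed _ _ _) _ _ (pushforward (mrestr P mE) VI)
  (density_measure (tleb R n) mw w0)) => //.
- move=> _; exists (fun=> setT) => //.
  by apply/seteqP; split.
- by rewrite bigcup_const.
- move=> _ [A mA <-]; rewrite /= /density_measure wE -(prob_admission_rect Hmodel I mA)//.
  by rewrite /pushforward /mrestr setIC.
- move=> _; rewrite /pushforward /mrestr; apply: (@le_lt_trans _ _ 1%E); last exact: ltry.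
  exact: (probability_le1 P (measurableI _ _
    (measurable_preimage (measurable_admitted V I) measurableT) mE)).
Qed.

Lemma ge0_integral_admission (f : T -> \bar R) :
  measurable_fun setT f -> (forall t, 0 <= f t)%E ->
  (\int[P]_t f t = \sum_(J : nset m n) \int[P]_(t in adm @^-1` [set J]) f t)%E.
Proof.
move=> mf f0.
have UT : \big[setU/set0]_(J <- index_enum (nset m n)) (adm @^-1` [set J]) = setT.
  rewrite -bigcup_seq; apply/seteqP; split => // t _.
  by exists (adm t) => //=; rewrite mem_index_enum.
rewrite -[in LHS]UT ge0_integral_bigsetU ?UT//.
- by move=> J; exact: (measurable_adm Hmodel).
- exact: index_enum_uniq.
- by apply/trivIsetP => J K _ _ JK; apply/seteqP; split => // t [/= ->]; apply/eqP.
Qed.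

Lemma card_nset : #|{: nset m n}| = 'C(m, n).
Proof. by rewrite card_sig -[in RHS](card_ord m) -card_draws cardsE. Qed.

Hypothesis nm : (n <= m)%N.

Lemma binR_gt0 : 0 < 'C(m, n)%:R :> R.
Proof. by rewrite ltr0n bin_gt0. Qed.

(** The admission events partition the sample space, and the mass is the probability of each of
    them, so C(m,n) copies of it add up to 1. *)
Lemma integral_weight :
  (\int[tleb R n]_(v in cube R n) (weight v)%:E = ('C(m, n)%:R^-1)%:E)%E.
Proof.
have probE (I : nset m n) : P (adm @^-1` [set I]) =
    (\int[tleb R n]_(v in cube R n) (weight v)%:E)%E.
  by rewrite -[cube R n]setTI -(prob_admission I)// preimage_setT setIT.
have intE : (\sum_(J : nset m n) \int[tleb R n]_(v in cube R n) (weight v)%:E = 1)%E.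
  rewrite -(probability_setT P) -[RHS]mul1e -integral_cst// (ge0_integral_admission _ _)//.
  apply: eq_bigr => J _; rewrite integral_cst ?mul1e//; last exact: (measurable_adm Hmodel).
  exact/esym/probE.
(* Finiteness, required before dividing, holds because the mass is a probability; a set of size n
   exists since n <= m. *)
have wfin : (\int[tleb R n]_(v in cube R n) (weight v)%:E)%E \is a fin_num.
  have : (0 < #|{: nset m n}|)%N by rewrite card_nset bin_gt0.
  move=> /card_gt0P[J _]; rewrite -(probE J); apply: fin_num_measure.
  exact: (measurable_adm Hmodel).
move: intE; rewrite -(fineK wfin) sumEFin sumr_const card_nset => -[] H; congr EFin; apply: (mulfI (lt0r_neq0 binR_gt0)).
by rewrite mulfV ?lt0r_neq0 ?binR_gt0// mulr_natl.
Qed.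

Lemma prob_adm (I : nset m n) : P (adm @^-1` [set I]) = ('C(m, n)%:R^-1)%:E.
Proof.
by rewrite -integral_weight -[cube R n]setTI -(prob_admission I)// preimage_setT setIT.
Qed.

Section Standard.
Variables (d' : measure_display) (T' : measurableType d') (Q : probability T' R).
Variables (W : {mfun T' >-> n.-tuple R}).

Lemma prob_standard (I : nset m n) (B : set (n.-tuple R)) :
  has_joint_density Q W (joint_density F I) -> measurable B ->
  P (adm @^-1` [set I] `&` admitted_valuations V I @^-1` B) =
  (('C(m, n)%:R^-1)%:E * Q (W @^-1` B))%E.
Proof.
move=> WQ mB; rewrite WQ// prob_admission//.
have mBc : measurable (B `&` cube R n) by exact: measurableI.
have mw : measurable_fun (B `&` cube R n) weight.
  by apply: (measurable_funS _ _ measurable_weight) => //; exact: subIsetr.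
have -> : (\int[tuple_lebesgue R n]_(v in B `&` cube R n) (joint_density F I v)%:E =
    'C(m, n)%:R%:E * \int[tleb R n]_(v in B `&` cube R n) (weight v)%:E)%E.
  rewrite -ge0_integralZl//.
  - by apply: eq_integral => v _; rewrite /joint_density -mulrA EFinM.
  - exact/measurable_EFinP.
  - by move=> v [_ cv]; rewrite lee_fin weight_ge0.
rewrite muleA -EFinM mulVf ?mul1e//; exact/lt0r_neq0/binR_gt0.
Qed.

Lemma ge0_integral_standard (I : nset m n) (D : set (n.-tuple R)) (f : n.-tuple R -> \bar R) :
  has_joint_density Q W (joint_density F I) ->
  measurable D -> measurable_fun D f -> (forall v, D v -> 0 <= f v)%E ->
  (\int[P]_(t in adm @^-1` [set I] `&` admitted_valuations V I @^-1` D)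
      f (admitted_valuations V I t) =
   ('C(m, n)%:R^-1)%:E * \int[Q]_(t in W @^-1` D) f (W t))%E.
Proof.
move=> WQ mD mf f0.
have C0 : 0 <= 'C(m, n)%:R^-1 :> R by rewrite invr_ge0.
rewrite -(@ge0_integral_image_on _ _ _ _ _ P
  (mscale (NngNum C0) (pushforward Q W)) (adm @^-1` [set I])
  (admitted_valuations V I))//.
- rewrite ge0_integral_mscale// ge0_integral_pushforward// => v /set_mem.
  exact: f0.
- exact: (measurable_adm Hmodel).
- exact: measurable_admitted.
- by move=> B mB _; exact: (prob_standard WQ mB).
Qed.

End Standard.
End AdmissionLaw.

(** * Posterior beliefs *)

Section JoinCube.
Context {R : realType}.
Variables (n : nat) (k : 'I_n).

Lemma cube_join x w : cube R n (join k x w) <-> unit_itv R x /\ cube R n.-1 w.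
Proof.
split=> [H|[ux cw] j].
  by split => [|j]; [have := H k; rewrite tnth_join | have := H (lift k j); rewrite tnth_join_lift].
by case: (unliftP k j) => [l ->|->]; rewrite ?tnth_join_lift ?tnth_join.
Qed.

Lemma slab_cube : slab k (unit_itv R) (cube R n.-1) = cube R n.
Proof.
apply/seteqP; split => v; first by move=> [uv cv]; rewrite -(othersK k v); exact/cube_join.
by rewrite -{1}(othersK k v) => /cube_join[uv cv].
Qed.

Lemma sub_slab_cube A B : A `<=` unit_itv R -> B `<=` cube R n.-1 ->
  slab k A B `<=` cube R n.
Proof. by move=> Au Bc v [Av Bv]; rewrite -slab_cube; split; [exact: Au|exact: Bc]. Qed.

Lemma measurable_join_on (h : n.-tuple R -> R) : measurable_fun (cube R n) h ->
  measurable_fun (unit_itv R `*` cube R n.-1) (fun p => h (join k p.1 p.2)).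
Proof.
move=> mh; apply: (measurable_comp (@measurable_cube R n) _ mh
  (measurable_funTS (measurable_join k))) => _ [p [up cp] <-].
exact/cube_join.
Qed.

Variable h : n.-tuple R -> R.
Hypothesis mh : measurable_fun (cube R n) h.
Hypothesis h0 : forall v, cube R n v -> 0 <= h v.

Lemma integral_cube_slab A B : measurable A -> measurable B ->
  A `<=` unit_itv R -> B `<=` cube R n.-1 ->
  (\int[tleb R n]_(v in slab k A B) (h v)%:E =
   \int[leb R]_(x in A) \int[tleb R n.-1]_(w in B) (h (join k x w))%:E)%E.
Proof.
move=> mA mB Au Bc; apply: integral_slab => //.
  apply/measurable_EFinP; apply: (measurable_funS _ _ mh) => //.
  exact: sub_slab_cube.
by move=> v /(sub_slab_cube Au Bc); rewrite lee_fin; exact: h0.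
Qed.

Lemma measurable_marginal (B : set (n.-1.-tuple R)) : measurable B -> B `<=` cube R n.-1 ->
  measurable_fun (unit_itv R) (fun x => \int[tleb R n.-1]_(w in B) (h (join k x w))%:E)%E.
Proof.
move=> mB Bc.
apply: (@measurable_integral_section _ _ _ _ _ (tleb R n.-1) _ _
  (fun p => (h (join k p.1 p.2))%:E)) => //.
- apply/measurable_EFinP; apply: (measurable_funS _ _ (measurable_join_on mh)).
    by apply: measurableX.
  by move=> p [? ?]; split => //; exact: Bc.
- by move=> p [up /Bc cp]; rewrite lee_fin h0//; exact/cube_join.
Qed.

End JoinCube.

(** * Marginals of the unnormalized density *)

Section Marginal.
Variables (R : realType) (m n : nat) (F : predictor R).
Local Notation weight := (@weight R m n F).

Lemma psi_le1 (v : n.-tuple R) : psi m F v <= 1.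
Proof.
have [nm|nm] := boolP (n < m)%N; last by rewrite /psi (negbTE nm).
rewrite -lee_fin psiE//.
apply: (@le_trans _ _ (\int[lsm F (m - n)]_(x in unit_itv R) 1)%E).
  apply: ge0_le_integral => //.
  - by move=> x _; rewrite lee_fin survival_ge0.
  - by apply/measurable_EFinP/measurable_funTS; exact: measurable_survival_r.
  - by move=> x _; rewrite lee_fin survival_le1.
rewrite integral_cst// mul1e.
apply: (@le_trans _ _ (lsm F (m - n) `]-1, 1]%classic)).
  apply: measure_subset => // x; rewrite /unit_itv/= !in_itv/= => /andP[x0 ->].
  by rewrite (lt_le_trans _ x0)// ltrN10.
have cdfN1 : signal_cdf F (-1) = 0 by apply: signal_cdf_le0; rewrite lerN10.
rewrite lsm_itv_bnd ?lerN10// lee_fin cdfN1 expr0n subn_eq0 leqNgt nm subr0 exprn_ile1 ?signal_cdf_ge0//.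
rewrite -lee_fin /signal_cdf fineK; first by apply: probability_le1; exact: measurableX.
by apply: fin_num_measure; exact: measurableX.
Qed.

Section Coordinate.
Variable k : 'I_n.

(** The numerator of [bayes_posterior]: the weight without the own factor f_1(x), which cancels in
    Bayes' rule. *)
Definition others_weight (x : R) (w : n.-1.-tuple R) : R :=
  psi m F (join k x w) * \prod_(j < n.-1) f1 F (tnth w j).

Lemma weight_join x w : weight (join k x w) = f1 F x * others_weight x w.
Proof.
rewrite /weight /others_weight (bigD1_ord k)//= tnth_join mulrCA; congr (_ * (_ * _)).
by apply: eq_bigr => j _; rewrite tnth_join_lift.
Qed.

Lemma others_weight_ge0 x w : cube R n.-1 w -> 0 <= others_weight x w.
Proof.
move=> cw; rewrite mulr_ge0 ?psi_ge0// prodr_ge0// => j _.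
by rewrite ltW// f1_gt0.
Qed.

Lemma measurable_others_weight :
  measurable_fun (unit_itv R `*` cube R n.-1) (fun p => others_weight p.1 p.2).
Proof.
apply: measurable_funM.
  by apply: measurable_funTS; exact: (measurableT_comp (measurable_psi m F) (measurable_join k)).
have msnd : measurable_fun (unit_itv R `*` cube R n.-1)
    (snd : R * n.-1.-tuple R -> n.-1.-tuple R) by exact: measurable_funTS.
apply: (measurable_comp (@measurable_cube R n.-1) _ (@measurable_prod_f1 R F n.-1) msnd).
by move=> _ [p [_ cp] <-].
Qed.

Lemma measurable_others_weight_r x (B : set (n.-1.-tuple R)) :
  measurable B -> B `<=` cube R n.-1 -> measurable_fun B (others_weight x).
Proof.
move=> mB Bc; apply: measurable_funM.
  have mj : measurable_fun setT (fun w : n.-1.-tuple R => (x, w)) by exact: measurable_fun_pair.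
  apply: measurable_funTS.
  exact: (measurableT_comp (measurable_psi m F) (measurableT_comp (measurable_join k) mj)).
exact: (measurable_funS _ Bc (@measurable_prod_f1 R F n.-1)).
Qed.

Definition bayes_denominator (x : R) : R :=
  fine (\int[tleb R n.-1]_(w in cube R n.-1) (others_weight x w)%:E)%E.

(** Nothing is lost by [fine]: psi is at most 1 and the i.i.d. prior of the others has mass 1. *)
Lemma bayes_denominatorE x :
  (bayes_denominator x)%:E = (\int[tleb R n.-1]_(w in cube R n.-1) (others_weight x w)%:E)%E.
Proof.
rewrite /bayes_denominator fineK// ge0_fin_numE; last first.
  by apply: integral_ge0 => w cw; rewrite lee_fin others_weight_ge0.
apply: (@le_lt_trans _ _
  (\int[tleb R n.-1]_(w in cube R n.-1) (\prod_(j < n.-1) f1 F (tnth w j))%:E)%E).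
  apply: ge0_le_integral => //.
  - by move=> w cw; rewrite lee_fin others_weight_ge0.
  - by apply/measurable_EFinP; exact: measurable_others_weight_r.
  - by apply/measurable_EFinP; exact: measurable_prod_f1.
  - move=> w cw; rewrite lee_fin /others_weight ler_piMl ?psi_le1//.
    by apply: prodr_ge0 => j _; rewrite ltW// f1_gt0.
rewrite (@integral_rect_prod R n.-1 (fun=> unit_itv R) (fun=> f1 F)).
- rewrite big1 ?ltry// => j _; transitivity (law F (setT `*` setT)).
    rewrite f1_density// setTI ge0_integral_leb//.
      by have mf1 := measurable_f1 F; exact/measurable_EFinP.
    by move=> v uv; rewrite lee_fin ltW// f1_gt0.
  by rewrite setXTT probability_setT.
- by move=> j; exact: measurable_unit.
- by move=> j; exact: measurable_f1.
- by move=> j v uv; rewrite ltW// f1_gt0.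
Qed.

Lemma bayes_denominator_ge0 x : 0 <= bayes_denominator x.
Proof.
rewrite -lee_fin bayes_denominatorE; apply: integral_ge0 => w cw.
by rewrite lee_fin others_weight_ge0.
Qed.

Definition marginal_weight (x : R) : R := f1 F x * bayes_denominator x.

Lemma marginal_weightE x : unit_itv R x ->
  (marginal_weight x)%:E =
  (\int[tleb R n.-1]_(w in cube R n.-1) (weight (join k x w))%:E)%E.
Proof.
move=> ux; rewrite EFinM bayes_denominatorE -ge0_integralZl//.
- by apply: eq_integral => w _; rewrite weight_join EFinM.
- by apply/measurable_EFinP; exact: measurable_others_weight_r.
- by move=> w cw; rewrite lee_fin others_weight_ge0.
- by rewrite lee_fin ltW// f1_gt0.
Qed.

Lemma marginal_weight_ge0 x : unit_itv R x -> 0 <= marginal_weight x.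
Proof. by move=> ux; rewrite mulr_ge0 ?bayes_denominator_ge0// ltW// f1_gt0. Qed.

Lemma measurable_bayes_denominator : measurable_fun (unit_itv R) bayes_denominator.
Proof.
apply/measurable_EFinP.
apply: (eq_measurable_fun (fun x => \int[tleb R n.-1]_(w in cube R n.-1) (others_weight x w)%:E)%E).
  by move=> x _ /=; rewrite bayes_denominatorE.
apply: (@measurable_integral_section _ _ _ _ _ (tleb R n.-1) (unit_itv R) (cube R n.-1)
  (fun p => (others_weight p.1 p.2)%:E)) => //.
- by apply/measurable_EFinP; exact: measurable_others_weight.
- by move=> p [_ cp]; rewrite lee_fin others_weight_ge0.
Qed.

Lemma measurable_marginal_weight : measurable_fun (unit_itv R) marginal_weight.
Proof.
by apply: measurable_funM; [exact: measurable_f1 | exact: measurable_bayes_denominator].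
Qed.

End Coordinate.

(** Almost every vector avoids, in each of its finitely many coordinates, the null set left out by
    [kernel_le0_ae]. *)
Lemma ae_weight_gt0 : {ae tleb R n, forall v, cube R n v -> 0 < weight v}.
Proof.
have H k : {ae tleb R n, forall v, unit_itv R (tnth v k) -> cond_signal_cdf F 0 (tnth v k) = 0}.
  apply: (negligible_split k (fun x _ => unit_itv R x -> cond_signal_cdf F 0 x = 0)).1.
  exact: ae_fst (kernel_le0_ae F).
have : {ae tleb R n, forall v, forall k,
    unit_itv R (tnth v k) -> cond_signal_cdf F 0 (tnth v k) = 0} by exact: filter_forall.
apply: filterS => v Hv cv; rewrite mulr_gt0 ?psi_gt0//.
  by move=> k; apply: Hv; exact: cv.
by apply: prodr_gt0 => k _; rewrite f1_gt0.
Qed.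

Lemma leb_unit : leb R (unit_itv R) = 1%E.
Proof. by rewrite /leb /unit_itv lebesgue_measure_itv/= lte_fin ltr01 sube0. Qed.

Lemma tleb_cube p : tleb R p (cube R p) = 1%E.
Proof.
rewrite /tleb (@tuple_lebesgue_rect R p (fun=> unit_itv R)).
  by rewrite big1// => k _; exact: leb_unit.
by move=> k; exact: measurable_unit.
Qed.

(** A vanishing marginal at x would make [weight] vanish almost everywhere on the section at x, a
    cube of measure 1, although it is positive almost everywhere on almost every section. *)
Lemma ae_marginal_weight_gt0 k :
  {ae leb R, forall x, unit_itv R x -> 0 < marginal_weight k x}.
Proof.
have : {ae tleb R n, forall v,
    cube R n (join k (tnth v k) (others k v)) -> 0 < weight (join k (tnth v k) (others k v))}.
  by apply: filterS ae_weight_gt0 => v; rewrite othersK.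
move=> /(negligible_split k (fun x w => cube R n (join k x w) -> 0 < weight (join k x w))).2.
move=> /(ae_xsection (P := fun x w => cube R n (join k x w) -> 0 < weight (join k x w))).
apply: filterS => x Hx ux.
rewrite lt_neqAle marginal_weight_ge0// andbT; apply/eqP => mw0.
have mw : measurable_fun (cube R n.-1) (fun w => (weight (join k x w))%:E).
  apply/measurable_EFinP; under eq_fun do rewrite weight_join.
  by apply: measurable_funM => //; exact: measurable_others_weight_r.
have : (\int[tleb R n.-1]_(w in cube R n.-1) `|(weight (join k x w))%:E| = 0)%E.
  rewrite -[RHS]/(0%:E) mw0 marginal_weightE//; apply: eq_integral => w /set_mem cw.
  by rewrite gee0_abs// lee_fin weight_ge0//; exact/cube_join.
move/(ae_eq_integral_abs (tleb R n.-1) (@measurable_cube R n.-1) mw) => ae0.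
have : {ae tleb R n.-1, forall w, ~ cube R n.-1 w}.
  apply: filterS2 Hx ae0 => w wgt0 w0 cw.
  have := wgt0; rewrite cube_join => /(_ (conj ux cw)).
  by have [->] := w0 cw; rewrite ltxx.
move=> [N [mN N0 subN]].
have : tleb R n.-1 (cube R n.-1) = 0%E.
  by apply: (subset_measure0 _ mN _ N0) => // w cw; apply: subN => /=; apply.
by rewrite tleb_cube => /eqP; rewrite onee_eq0.
Qed.

End Marginal.

(** * Versions of the posterior density *)

Section Belief.
Variables (R : realType) (m n : nat) (F : predictor R).
Variables (d : measure_display) (T : measurableType d) (P : probability T R).
Variables (V S : 'I_m -> {RV P >-> R}) (adm : T -> nset m n).
Hypothesis Hmodel : prescreening F V S adm.
Variables (I : nset m n) (k : 'I_n).
Local Notation weight := (@weight R m n F).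
Local Notation mw := (@marginal_weight R m n F k).
Local Notation VI := (admitted_valuations V I).
Local Notation E := (adm @^-1` [set I]).

(** Turns the outer integral over states in [is_belief] into a Lebesgue integral against the density
    of V_k on the admission event. *)
Lemma integral_own_valuation (A : set R) (phi : R -> \bar R) :
  measurable A -> A `<=` unit_itv R -> measurable_fun A phi ->
  (forall x, A x -> 0 <= phi x)%E ->
  (\int[P]_(t in E `&` [set t | A (tnth (VI t) k)]) phi (tnth (VI t) k) =
   \int[leb R]_(x in A) (phi x * (mw x)%:E))%E.
Proof.
move=> mA Au mphi phi0.
pose f := mw \_ (unit_itv R).
have mf : measurable_fun setT (EFin \o f).
  apply/measurable_EFinP; apply/(measurable_restrictT _ _).1 => //.
  exact: measurable_marginal_weight.
have f0 x : (0 <= (EFin \o f) x)%E.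
  by rewrite lee_fin /f patchE; case: ifPn => // /set_mem; exact: marginal_weight_ge0.
have fE x : unit_itv R x -> f x = mw x by move=> ux; rewrite /f patchE mem_set.
rewrite -(@ge0_integral_image_on _ _ _ _ _ P (density_measure (leb R) mf f0) E
  (fun t => tnth (VI t) k))//; last 3 first.
- exact: (measurable_adm Hmodel).
- by apply: (measurableT_comp (measurable_tnth k)); exact: measurable_admitted.
- move=> B mB BA; rewrite /= /density_measure.
  transitivity (P (E `&` VI @^-1` [set v | B (tnth v k)])) => //.
  have mBk : measurable [set v : n.-tuple R | B (tnth v k)].
    exact: (measurable_preimage (measurable_tnth k) mB).
  rewrite (prob_admission Hmodel)//.
  have -> : [set v : n.-tuple R | B (tnth v k)] `&` cube R n = slab k B (cube R n.-1).
    rewrite -(slab_cube k); apply/seteqP; split => v; first by move=> [Bv [_ cv]]; split.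
    by move=> [Bv cv]; split => //; split => //; exact/Au/BA.
  have Bu := subset_trans BA Au.
  rewrite (integral_cube_slab k (measurable_weight m F))//; last exact: weight_ge0.
  apply: eq_integral => x /set_mem Bx /=.
  by rewrite fE ?marginal_weightE//; exact: Bu.
rewrite integral_density//; apply: eq_integral => x /set_mem Ax.
by rewrite fE//; exact: Au.
Qed.

Lemma prob_slab A B : measurable A -> measurable B ->
  A `<=` unit_itv R -> B `<=` cube R n.-1 ->
  P (E `&` [set t | A (tnth (VI t) k) /\ B (others k (VI t))]) =
  (\int[leb R]_(x in A) \int[tleb R n.-1]_(w in B) (weight (join k x w))%:E)%E.
Proof.
move=> mA mB Au Bc.
transitivity (P (E `&` VI @^-1` (slab k A B))) => //.
rewrite (prob_admission Hmodel); last exact: measurable_slab.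
rewrite setIidl; last exact: sub_slab_cube.
rewrite (integral_cube_slab k (measurable_weight m F))//; exact: weight_ge0.
Qed.

Lemma is_belief_bayes : is_belief P E VI k (bayes_posterior F I k).
Proof.
have bayesE x w : bayes_posterior F I k x w =
    others_weight m F k x w * (bayes_denominator m F k x)^-1 by [].
split.
- apply: measurable_funM; first exact: measurable_others_weight.
  have mfst : measurable_fun (unit_itv R `*` cube R n.-1)
    (fst : R * n.-1.-tuple R -> R) by exact: measurable_funTS.
  have mD : measurable_fun (unit_itv R) (fun x => (bayes_denominator m F k x)^-1).
    (* The inverse is written as a power with exponent -1, which is measurable on the whole line and
       agrees with it on nonnegative numbers. *)
    apply: (eq_measurable_fun (fun x => bayes_denominator m F k x `^ (-1))).
      by move=> x _; rewrite powR_inv1// bayes_denominator_ge0.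
    exact: (measurableT_comp (measurable_powR (-1)) (measurable_bayes_denominator m F k)).
  apply: (measurable_comp (@measurable_unit R) _ mD mfst).
  by move=> _ [p [up _] <-].
- move=> x w ux cw; rewrite bayesE mulr_ge0 ?others_weight_ge0//.
  by rewrite invr_ge0 bayes_denominator_ge0.
move=> A B mA mB Au Bc; rewrite prob_slab//.
have intB x : (\int[tleb R n.-1]_(w in B) (bayes_posterior F I k x w)%:E =
    \int[tleb R n.-1]_(w in B) (others_weight m F k x w)%:E *
    ((bayes_denominator m F k x)^-1)%:E)%E.
  rewrite -ge0_integralZr//.
  - by apply/measurable_EFinP; exact: measurable_others_weight_r.
  - by move=> w /Bc cw; rewrite lee_fin others_weight_ge0.
  - by rewrite lee_fin invr_ge0 bayes_denominator_ge0.
have mOB : measurable_fun (unit_itv R)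
    (fun x => \int[tleb R n.-1]_(w in B) (others_weight m F k x w)%:E)%E.
  apply: (@measurable_integral_section _ _ _ _ _ (tleb R n.-1) (unit_itv R) B
    (fun p => (others_weight m F k p.1 p.2)%:E)) => //.
  - apply/measurable_EFinP; apply: (measurable_funS _ _ (measurable_others_weight m F k)).
      exact: measurableX.
    by move=> p [up Bp]; split => //; exact: Bc.
  - by move=> p [_ /Bc cp]; rewrite lee_fin others_weight_ge0.
rewrite (@integral_own_valuation A (fun x =>
  \int[tleb R n.-1]_(w in B) (bayes_posterior F I k x w)%:E)%E)//; last 2 first.
- under eq_fun do rewrite intB.
  apply: (measurable_funS _ Au) => //; apply: emeasurable_funM => //.
  apply/measurable_EFinP.
  apply: (eq_measurable_fun (fun x => bayes_denominator m F k x `^ (-1))).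
    by move=> x _; rewrite powR_inv1// bayes_denominator_ge0.
  exact: (measurableT_comp (measurable_powR (-1)) (measurable_bayes_denominator m F k)).
- move=> x Ax; rewrite intB mule_ge0//; last by rewrite lee_fin invr_ge0 bayes_denominator_ge0.
  by apply: integral_ge0 => w /Bc cw; rewrite lee_fin others_weight_ge0.
apply: eq_integral => x /set_mem /Au ux; rewrite intB.
have -> : (\int[tleb R n.-1]_(w in B) (weight (join k x w))%:E =
    (f1 F x)%:E * \int[tleb R n.-1]_(w in B) (others_weight m F k x w)%:E)%E.
  rewrite -ge0_integralZl//.
  - by apply: eq_integral => w _; rewrite weight_join EFinM.
  - by apply/measurable_EFinP; exact: measurable_others_weight_r.
  - by move=> w /Bc cw; rewrite lee_fin others_weight_ge0.
  - by rewrite lee_fin ltW// f1_gt0.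
have int_ge0 : (0 <= \int[tleb R n.-1]_(w in B) (others_weight m F k x w)%:E)%E.
  by apply: integral_ge0 => w /Bc cw; rewrite lee_fin others_weight_ge0.
have int_le : (\int[tleb R n.-1]_(w in B) (others_weight m F k x w)%:E <=
    (bayes_denominator m F k x)%:E)%E.
  rewrite bayes_denominatorE; apply: ge0_subset_integral => //.
    by apply/measurable_EFinP; exact: measurable_others_weight_r.
  by move=> w cw; rewrite lee_fin others_weight_ge0.
(* If the denominator is 0, it forces the integral of the numerator over B, which it bounds, to be 0
   as well. *)
have [D0|D0] := eqVneq (bayes_denominator m F k x) 0.
  have -> : (\int[tleb R n.-1]_(w in B) (others_weight m F k x w)%:E = 0)%E.
    by apply/eqP; rewrite eq_le int_ge0 andbT; move: int_le; rewrite D0.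
  by rewrite mule0 !mul0e.
by rewrite -muleA -EFinM /marginal_weight mulrCA mulVf// mulr1 muleC.
Qed.

Lemma measurable_belief_section (b : R -> n.-1.-tuple R -> R) (B : set (n.-1.-tuple R)) :
  measurable_fun (unit_itv R `*` cube R n.-1) (fun p => b p.1 p.2) ->
  (forall x w, unit_itv R x -> cube R n.-1 w -> 0 <= b x w) ->
  measurable B -> B `<=` cube R n.-1 ->
  measurable_fun (unit_itv R) (fun x => \int[tleb R n.-1]_(w in B) (b x w)%:E)%E.
Proof.
move=> mb b0 mB Bc.
apply: (@measurable_integral_section _ _ _ _ _ (tleb R n.-1) (unit_itv R) B
    (fun p => (b p.1 p.2)%:E)) => //.
- apply/measurable_EFinP; apply: (measurable_funS _ _ mb); first exact: measurableX.
  by move=> p [up Bp]; split => //; exact: Bc.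
- by move=> p [up /Bc cp]; rewrite lee_fin b0.
Qed.

Lemma belief_ae (b : R -> n.-1.-tuple R -> R) : is_belief P E VI k b ->
  {ae (leb R \x tleb R n.-1)%E, forall p, (unit_itv R `*` cube R n.-1) p ->
    weight (join k p.1 p.2) = b p.1 p.2 * mw p.1}.
Proof.
move=> [mb b0 bE].
have mwj := measurable_join_on k (measurable_weight m F).
have mmw : measurable_fun (unit_itv R `*` cube R n.-1)
    (fun p : R * n.-1.-tuple R => mw p.1).
  have mfst : measurable_fun (unit_itv R `*` cube R n.-1)
    (fst : R * n.-1.-tuple R -> R) by exact: measurable_funTS.
  apply: (measurable_comp (@measurable_unit R) _ (measurable_marginal_weight m F k) mfst).
  by move=> _ [p [up _] <-].
have mbm : measurable_fun (unit_itv R `*` cube R n.-1) (fun p => b p.1 p.2 * mw p.1).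
  exact: measurable_funM.
have wj0 p : (unit_itv R `*` cube R n.-1) p -> 0 <= weight (join k p.1 p.2).
  by move=> [up cp]; apply: weight_ge0; exact/cube_join.
have bm0 p : (unit_itv R `*` cube R n.-1) p -> 0 <= b p.1 p.2 * mw p.1.
  by move=> [up cp]; rewrite mulr_ge0 ?b0 ?marginal_weight_ge0.
have sub A B : A `<=` unit_itv R -> B `<=` cube R n.-1 ->
    A `*` B `<=` unit_itv R `*` cube R n.-1.
  by move=> Au Bc p [Ap Bp]; split; [exact: Au | exact: Bc].
have mUC : measurable (unit_itv R `*` cube R n.-1) by exact: measurableX.
have wjE A B : measurable A -> measurable B -> A `<=` unit_itv R -> B `<=` cube R n.-1 ->
    (\int[leb R \x tleb R n.-1]_(p in A `*` B) (weight (join k p.1 p.2))%:E =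
     P (E `&` [set t | A (tnth (VI t) k) /\ B (others k (VI t))]))%E.
  move=> mA mB Au Bc; rewrite prob_slab// integral_prodX//.
    by apply/measurable_EFinP; exact: (measurable_funS _ (sub _ _ Au Bc) mwj).
  by move=> p /(sub _ _ Au Bc) /wj0; rewrite lee_fin.
apply: (ae_eq_rectangles (f := fun p => weight (join k p.1 p.2))
  (g := fun p => b p.1 p.2 * mw p.1)) => //.
  rewrite wjE//; apply: (@le_lt_trans _ _ 1%E); last exact: ltry.
  apply: probability_le1; apply: measurableI; first exact: (measurable_adm Hmodel).
  exact: (measurable_preimage (measurable_admitted V I)
    (measurable_slab k (@measurable_unit R) (@measurable_cube R n.-1))).
move=> A B mA mB Au Bc; rewrite wjE// bE//.
rewrite (@integral_own_valuation A (fun x => \int[tleb R n.-1]_(w in B) (b x w)%:E)%E)//; last 2 first.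
- exact: (measurable_funS _ Au (measurable_belief_section mb b0 mB Bc)).
- move=> x /Au ux; apply: integral_ge0 => w /Bc cw; rewrite lee_fin; exact: b0.
rewrite integral_prodX//; last 2 first.
- by apply/measurable_EFinP; exact: (measurable_funS _ (sub _ _ Au Bc) mbm).
- by move=> p /(sub _ _ Au Bc) /bm0; rewrite lee_fin.
apply: eq_integral => x /set_mem /Au ux; rewrite -ge0_integralZr//.
- apply/measurable_EFinP; apply: (measurable_funS _ Bc) => //.
  have mx : measurable_fun (cube R n.-1) (fun w : n.-1.-tuple R => (x, w)).
    by apply: measurable_funTS; exact: measurable_fun_pair.
  by apply: (measurable_comp mUC _ mb mx) => _ [w cw <-].
- by move=> w /Bc cw; rewrite lee_fin b0.
- by rewrite lee_fin marginal_weight_ge0.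
Qed.

(** The same relation for vectors, with the positivity that permits dividing by the marginal. *)
Lemma belief_split_ae (b : R -> n.-1.-tuple R -> R) : is_belief P E VI k b ->
  {ae tleb R n, forall v, cube R n v ->
    weight v = b (tnth v k) (others k v) * mw (tnth v k) /\ 0 < mw (tnth v k)}.
Proof.
move=> /belief_ae /(negligible_split k (fun x w => (unit_itv R `*` cube R n.-1) (x, w) ->
  weight (join k x w) = b x w * mw x)).1 Hb.
have /(negligible_split k (fun x _ => unit_itv R x -> 0 < mw x)).1 Hmw :
    {ae (leb R \x tleb R n.-1)%E, forall p, unit_itv R p.1 -> 0 < mw p.1}.
  exact: ae_fst (ae_marginal_weight_gt0 m F k).
apply: filterS2 Hb Hmw => v; rewrite othersK => Hb Hmw cv.
have [uv cv'] : slab k (unit_itv R) (cube R n.-1) v by rewrite slab_cube.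
by split; [exact: Hb | exact: Hmw].
Qed.

End Belief.

(** Infinite values are covered because the seller's payoff need not be integrable: both parts of
    its integral may be infinite. *)
Lemma mule_subr_pos (R : realType) (p : R) (x y : \bar R) : 0 < p ->
  (0 <= x -> 0 <= y -> p%:E * x - p%:E * y = p%:E * (x - y))%E.
Proof.
move=> p0; case: x => [x||]// _; case: y => [y||]// _.
- by rewrite muleBr.
- by rewrite gt0_muley ?lte_fin// !addeNy gt0_muleNy ?lte_fin.
- by rewrite gt0_muley ?lte_fin// -EFinM -!EFinN !addye// gt0_muley ?lte_fin.
- by rewrite !gt0_muley ?lte_fin//= gt0_muleNy ?lte_fin.
Qed.

Lemma eq_law_integral d1 d2 d (X : measurableType d1) (X' : measurableType d2)
    (Y : measurableType d) (R : realType) (mu : {measure set X -> \bar R})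
    (mu' : {measure set X' -> \bar R}) (phi : X -> Y) (phi' : X' -> Y) (f : Y -> \bar R) :
  measurable_fun setT phi -> measurable_fun setT phi' ->
  (forall B, measurable B -> mu (phi @^-1` B) = mu' (phi' @^-1` B)) ->
  measurable_fun setT f ->
  (\int[mu]_x f (phi x) = \int[mu']_x f (phi' x))%E.
Proof.
move=> mphi mphi' muE mf; pose pm := isMeasurableFun.Build _ _ _ _ _ mphi'.
pose psi : {mfun X' >-> Y} := HB.pack phi' pm.
have H (g : Y -> \bar R) : measurable_fun setT g -> (forall y, 0 <= g y)%E ->
    (\int[mu]_x g (phi x) = \int[mu']_x g (phi' x))%E.
  move=> mg g0.
  rewrite -[LHS](@ge0_integral_image _ _ _ _ _ mu (pushforward mu' psi) phi setT)//.
  by rewrite ge0_integral_pushforward// preimage_setT.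
rewrite [LHS]integralE [RHS]integralE; congr (_ - _)%E.
  transitivity (\int[mu]_x (f^\+)%E (phi x))%E; first by apply: eq_integral => x _; rewrite !funeposE.
  by rewrite H//; [apply: eq_integral => x _; rewrite !funeposE | exact: measurable_funepos].
transitivity (\int[mu]_x (f^\-)%E (phi x))%E; first by apply: eq_integral => x _; rewrite !funenegE.
by rewrite H//; [apply: eq_integral => x _; rewrite !funenegE | exact: measurable_funeneg].
Qed.

(** * Uniqueness of the symmetric density *)

Section Uniqueness.
Variables (R : realType) (m n : nat) (F : predictor R).
Variables (d : measure_display) (T : measurableType d) (P : probability T R).
Variables (V S : 'I_m -> {RV P >-> R}) (adm : T -> nset m n).
Hypothesis Hmodel : prescreening F V S adm.
Hypothesis nm : (n <= m)%N.
Variable I : nset m n.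
Local Notation weight := (@weight R m n F).
Local Notation mw := (@marginal_weight R m n F).
Local Notation VI := (admitted_valuations V I).
Local Notation E := (adm @^-1` [set I]).

Variables (h : n.-tuple R -> R) (b : 'I_n -> R -> n.-1.-tuple R -> R).
Hypothesis hd : is_density h.
Hypothesis hb : forall k, is_belief P E VI k (b k).
Hypothesis hcond : forall k, {ae tuple_lebesgue R n, forall v, cube R n v ->
  0 < marginal_density h k (tnth v k) ->
  cond_density h k (tnth v k) (others k v) = b k (tnth v k) (others k v)}.

Lemma marginal_density_ge0 k x : unit_itv R x -> 0 <= marginal_density h k x.
Proof.
have [_ h0 _] := hd.
move=> ux; rewrite fine_ge0//; apply: integral_ge0 => w cw.
by rewrite lee_fin h0//; exact/cube_join.
Qed.

(** The product form also covers the vectors at which the marginal of h is 0, where the hypothesis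
    on conditional densities is silent. *)
Lemma density_marginal_weight k : {ae tleb R n, forall v, cube R n v ->
  h v * mw k (tnth v k) = marginal_density h k (tnth v k) * weight v}.
Proof.
have [mh h0 h1] := hd.
pose H x : \bar R := (\int[tleb R n.-1]_(w in cube R n.-1) (h (join k x w))%:E)%E.
have mH : measurable_fun (unit_itv R) H.
  exact: (measurable_marginal k mh h0 (@measurable_cube R n.-1)).
have H0 x : unit_itv R x -> (0 <= H x)%E.
  by move=> ux; apply: integral_ge0 => w cw; rewrite lee_fin h0//; exact/cube_join.
have iH : (leb R).-integrable (unit_itv R) H.
  apply/integrableP; split => //.
  apply: (@le_lt_trans _ _ 1%E); last exact: ltry.
  have <- : (\int[leb R]_(x in unit_itv R) H x = 1)%E.
    by rewrite -[RHS]h1 /H -(integral_cube_slab k mh h0)// slab_cube.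
  rewrite le_eqVlt; apply/orP; left; apply/eqP.
  by apply: eq_integral => x /set_mem ux; rewrite gee0_abs// H0.
(* An infinite marginal would be turned into 0 by [fine]; integrability of the extended-valued
   marginal confines this to a null set. *)
have /(negligible_split k (fun x _ => unit_itv R x -> H x \is a fin_num)).1 Hfin :
    {ae (leb R \x tleb R n.-1)%E, forall p, unit_itv R p.1 -> H p.1 \is a fin_num}.
  exact: ae_fst (integrable_ae (@measurable_unit R) iH).
(* Above the zeros of the marginal, h integrates to 0 and so vanishes almost everywhere; both sides
   of the identity are then 0. *)
pose A0 := unit_itv R `&` H @^-1` [set 0%E].
have mA0 : measurable A0 by apply: mH => //; exact: emeasurable_set1.
have A0u : A0 `<=` unit_itv R by exact: subIsetl.
have mslab : measurable (slab k A0 (cube R n.-1)) by exact: measurable_slab.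
have sslab : slab k A0 (cube R n.-1) `<=` cube R n by exact: sub_slab_cube.
have mhs : measurable_fun (slab k A0 (cube R n.-1)) (EFin \o h).
  by apply/measurable_EFinP; exact: (measurable_funS _ sslab mh).
have : (\int[tleb R n]_(v in slab k A0 (cube R n.-1)) `|(h v)%:E| = 0)%E.
  transitivity (\int[tleb R n]_(v in slab k A0 (cube R n.-1)) (h v)%:E)%E.
    by apply: eq_integral => v /set_mem /sslab cv; rewrite gee0_abs// lee_fin h0.
  rewrite (integral_cube_slab k mh h0)//.
  by apply: integral0_eq => x [_]; rewrite /H.
move/(ae_eq_integral_abs (tleb R n) mslab mhs) => Hzero.
have Hb := belief_split_ae Hmodel (hb k).
have Hc : {ae tleb R n, forall v, cube R n v -> 0 < marginal_density h k (tnth v k) ->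
  cond_density h k (tnth v k) (others k v) = b k (tnth v k) (others k v)} := hcond k.
apply: filterS2 (filterI Hb Hc) (filterI Hzero Hfin) => v [Hbv Hcv] [Hzv Hfv] cv.
have [uv cv'] : slab k (unit_itv R) (cube R n.-1) v by rewrite slab_cube.
have [wE _] := Hbv cv.
have := marginal_density_ge0 k uv; rewrite le_eqVlt => /orP[/eqP mh0|mh0].
  have Hv0 : H (tnth v k) = 0%E by rewrite -[LHS]fineK ?Hfv//; congr EFin; rewrite mh0.
  have hv0 : (h v)%:E = 0%E by apply: Hzv; split.
  by rewrite -mh0; move: hv0 => -[->]; rewrite !mul0r.
have hE : h v = b k (tnth v k) (others k v) * marginal_density h k (tnth v k).
  rewrite -Hcv// /cond_density othersK mulfVK//; exact: lt0r_neq0.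
by rewrite wE hE [RHS]mulrCA mulrA.
Qed.

Lemma density_unique : (1 < n)%N ->
  {ae tleb R n, forall v, cube R n v -> h v = joint_density F I v}.
Proof.
move=> n1; have [mh h0 h1] := hd.
pose k0 := Ordinal (ltnW n1); pose k1 := Ordinal n1.
have [j k1E] : exists j, k1 = lift k0 j.
  by case: (unliftP k0 k1) => [j ->|//]; exists j.
pose r k x := marginal_density h k x / mw k x.
have hr k : {ae tleb R n, forall v, cube R n v -> h v = r k (tnth v k) * weight v}.
  apply: filterS2 (density_marginal_weight k) (belief_split_ae Hmodel (hb k)).
  move=> v Hv Hmw cv; have [_ mw0] := Hmw cv.
  by rewrite /r mulrAC -Hv// mulfK// lt0r_neq0.
have : {ae tleb R n, forall v, unit_itv R (tnth v k0) -> cube R n.-1 (others k0 v) ->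
    r k0 (tnth v k0) = r k1 (tnth (others k0 v) j)}.
  apply: filterS2 (filterI (hr k0) (hr k1)) (ae_weight_gt0 m n F) => v [r0 r1] w0 uv cv'.
  have cv : cube R n v by rewrite -(slab_cube k0); split.
  have wv : weight v != 0 by rewrite lt0r_neq0// w0.
  rewrite tnth_mktuple -k1E; apply: (mulIf wv).
  exact: (etrans (esym (r0 cv)) (r1 cv)).
move=> /(negligible_split k0 (fun x w => unit_itv R x -> cube R n.-1 w ->
  r k0 x = r k1 (tnth w j))).2.
move=> /(ae_xsection (P := fun x w => unit_itv R x -> cube R n.-1 w ->
  r k0 x = r k1 (tnth w j))) [N [mN N0 subN]].
(* Almost every section is good and [0, 1] has positive measure, so some x0 has a good section;
   freezing it makes the ratio in the other coordinate constant. *)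
have [x0 ux0 Hx0] : exists2 x, unit_itv R x & ~ N x.
  apply: contrapT => H.
  have : leb R (unit_itv R) = 0%E.
    apply: (subset_measure0 _ mN _ N0) => // x ux.
    by apply: contrapT => Nx; apply: H; exists x.
  by rewrite leb_unit => /eqP; rewrite onee_eq0.
pose c := r k0 x0.
have {}Hx0 : {ae tleb R n.-1, forall w, unit_itv R x0 -> cube R n.-1 w ->
    c = r k1 (tnth w j)}.
  by apply: contrapT => H; apply: Hx0; apply: (subN x0).
have /(negligible_split k0 (fun _ w => unit_itv R x0 -> cube R n.-1 w ->
    c = r k1 (tnth w j))).1 Hc := ae_snd (leb R) Hx0.
have hc : {ae tleb R n, forall v, cube R n v -> h v = c * weight v}.
  apply: filterS2 Hc (hr k1) => v Hc r1 cv.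
  have [uv cv'] : slab k0 (unit_itv R) (cube R n.-1) v by rewrite slab_cube.
  by rewrite (Hc ux0 cv') tnth_mktuple -k1E; exact: r1.
have c0 : 0 <= c by rewrite divr_ge0 ?marginal_density_ge0 ?marginal_weight_ge0.
have mwt := measurable_weight m F (n := n).
(* Ratios are taken with respect to [weight], of mass 1/C(m,n), hence c is the binomial coefficient
   that turns [weight] into g. *)
have : c * 'C(m, n)%:R^-1 = 1.
  apply: EFin_inj; rewrite EFinM -(integral_weight Hmodel nm) -[RHS]h1.
  rewrite -ge0_integralZl//; last 2 first.
  - exact/measurable_EFinP.
  - by move=> v cv; rewrite lee_fin weight_ge0.
  apply: ge0_ae_eq_integral => //.
  - by apply: measurable_funeM; exact/measurable_EFinP.
  - exact/measurable_EFinP.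
  - by move=> v cv; rewrite mule_ge0// lee_fin weight_ge0.
  - by apply: filterS hc => v Hv cv; rewrite -EFinM Hv.
move=> /(congr1 (fun y => y * 'C(m, n)%:R)).
rewrite mulfVK ?mul1r; last by rewrite lt0r_neq0// binR_gt0.
move=> cE; apply: filterS hc => v Hv cv.
by rewrite Hv// cE /joint_density -mulrA.
Qed.

End Uniqueness.

(** * The density g and equivalence with the standard auction *)

Section Density.
Variables (R : realType) (m n : nat) (F : predictor R).
Variables (d : measure_display) (T : measurableType d) (P : probability T R).
Variables (V S : 'I_m -> {RV P >-> R}) (adm : T -> nset m n).
Hypothesis Hmodel : prescreening F V S adm.
Hypothesis nm : (n <= m)%N.
Variable I : nset m n.
Local Notation weight := (@weight R m n F).

Lemma joint_densityE v : joint_density F I v = 'C(m, n)%:R * weight v.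
Proof. by rewrite /joint_density -mulrA. Qed.

Lemma is_density_joint : is_density (joint_density F I).
Proof.
have mw := measurable_weight m F (n := n).
split.
- apply: (eq_measurable_fun (fun v => 'C(m, n)%:R * weight v)).
    by move=> v _; rewrite joint_densityE.
  exact: measurable_funM.
- by move=> v cv; rewrite joint_densityE mulr_ge0 ?weight_ge0.
transitivity ('C(m, n)%:R%:E * \int[tleb R n]_(v in cube R n) (weight v)%:E)%E.
  rewrite -ge0_integralZl//.
  - by apply: eq_integral => v _; rewrite joint_densityE EFinM.
  - exact/measurable_EFinP.
  - by move=> v cv; rewrite lee_fin weight_ge0.
rewrite (integral_weight Hmodel nm) -EFinM mulfV// lt0r_neq0//.
exact: binR_gt0.
Qed.

Lemma is_symmetric_joint : is_symmetric (joint_density F I).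
Proof.
move=> s v _; rewrite /joint_density psi_perm; congr (_ * _).
rewrite [RHS](reindex_inj (@perm_inj _ s))/=.
by apply: eq_bigr => k _; rewrite tnth_mktuple.
Qed.

Lemma cond_density_joint (k : 'I_n) x w : unit_itv R x ->
  cond_density (joint_density F I) k x w = weight (join k x w) / marginal_weight m F k x.
Proof.
move=> ux; have C0 : 'C(m, n)%:R != 0 :> R by rewrite lt0r_neq0// binR_gt0.
have margE : marginal_density (joint_density F I) k x = 'C(m, n)%:R * marginal_weight m F k x.
  rewrite -[RHS]/(fine ('C(m, n)%:R * marginal_weight m F k x)%:E); congr fine.
  rewrite EFinM marginal_weightE// -ge0_integralZl//.
  - by apply: eq_integral => w' _; rewrite joint_densityE EFinM.
  - apply/measurable_EFinP; under eq_fun do rewrite weight_join.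
    by apply: measurable_funM => //; exact: measurable_others_weight_r.
  - by move=> w' cw; rewrite lee_fin weight_ge0//; exact/cube_join.
by rewrite /cond_density margE joint_densityE invfM mulrACA mulfV// mul1r.
Qed.

(** Holds at every point, even where the denominator is 0: only f_1(v_k) > 0 is cancelled, and the
    remaining quotients are identical expressions. *)
Lemma cond_density_bayes (k : 'I_n) v : cube R n v ->
  cond_density (joint_density F I) k (tnth v k) (others k v) =
  bayes_posterior F I k (tnth v k) (others k v).
Proof.
move=> cv; have uv : unit_itv R (tnth v k) by exact: cv.
rewrite cond_density_joint// weight_join /marginal_weight invfM mulrACA mulfV ?mul1r//.
by rewrite lt0r_neq0// f1_gt0.
Qed.

Lemma cond_density_belief (k : 'I_n) (b : R -> n.-1.-tuple R -> R) :
  is_belief P (adm @^-1` [set I]) (admitted_valuations V I) k b ->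
  {ae tleb R n, forall v, cube R n v ->
    cond_density (joint_density F I) k (tnth v k) (others k v) = b (tnth v k) (others k v)}.
Proof.
move=> /(belief_split_ae Hmodel); apply: filterS => v Hv cv.
have [wE mw0] := Hv cv; have uv : unit_itv R (tnth v k) := cv k.
rewrite cond_density_joint//.
by rewrite othersK wE mulfK// lt0r_neq0.
Qed.

Variables (d' : measure_display) (T' : measurableType d') (Q : probability T' R).
Variable W : {mfun T' >-> n.-tuple R}.
Hypothesis WQ : has_joint_density Q W (joint_density F I).

Let C0 : 'C(m, n)%:R^-1 != 0 :> R.
Proof. by rewrite invr_neq0// lt0r_neq0// binR_gt0. Qed.

(** Both sides of the defining equation of a belief carry the same factor 1/C(m,n), which
    cancels. *)
Lemma is_belief_standard (k : 'I_n) (b : R -> n.-1.-tuple R -> R) :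
  is_belief P (adm @^-1` [set I]) (admitted_valuations V I) k b <->
  is_belief Q setT W k b.
Proof.
have key : measurable_fun (unit_itv R `*` cube R n.-1) (fun p => b p.1 p.2) ->
    (forall x w, unit_itv R x -> cube R n.-1 w -> 0 <= b x w) ->
    forall (A : set R) (B : set (n.-1.-tuple R)), measurable A -> measurable B ->
    A `<=` unit_itv R -> B `<=` cube R n.-1 ->
    (P (adm @^-1` [set I] `&` [set t | A (tnth (admitted_valuations V I t) k) /\
        B (others k (admitted_valuations V I t))]) =
      ('C(m, n)%:R^-1)%:E * Q (setT `&` [set t | A (tnth (W t) k) /\ B (others k (W t))]))%E /\
    (\int[P]_(t in adm @^-1` [set I] `&` [set t | A (tnth (admitted_valuations V I t) k)])
        \int[tuple_lebesgue R n.-1]_(w in B) (b (tnth (admitted_valuations V I t) k) w)%:E =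
      ('C(m, n)%:R^-1)%:E * \int[Q]_(t in setT `&` [set t | A (tnth (W t) k)])
        \int[tuple_lebesgue R n.-1]_(w in B) (b (tnth (W t) k) w)%:E)%E.
  move=> mb b0 A B mA mB Au Bc; rewrite !setTI; split.
    exact: (prob_standard Hmodel nm WQ (measurable_slab k mA mB)).
  have mAk : measurable [set v : n.-tuple R | A (tnth v k)].
    exact: (measurable_preimage (measurable_tnth k) mA).
  apply: (ge0_integral_standard Hmodel nm
    (f := fun v => \int[tleb R n.-1]_(w in B) (b (tnth v k) w)%:E)%E WQ mAk).
    apply: (measurable_comp mA _ (measurable_funS _ Au (measurable_belief_section mb b0 mB Bc))
      (measurable_funTS (measurable_tnth k))) => //.
    by move=> _ [v Av <-].
  by move=> v /Au uv; apply: integral_ge0 => w /Bc cw; rewrite lee_fin b0.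
split=> -[mb b0 bE]; split=> // A B mA mB Au Bc;
  have [H1 H2] := key mb b0 A B mA mB Au Bc.
- by apply: (muleI_EFin C0); rewrite -H1 -H2; exact: bE.
- by rewrite H1 H2; congr (_ * _)%E; exact: bE.
Qed.

Section Seller.
Variables (dA : measure_display) (A : measurableType dA).
Variables (fmt : auction_format R n A) (sigma : strategy_profile R n A).

Lemma measurable_seller_play :
  measurable_fun setT (fun v : n.-tuple R => seller fmt (play sigma v)).
Proof.
have mplay : measurable_fun setT (@play R n dA A sigma).
  apply/measurable_fun_tnthP => k.
  rewrite (_ : _ \o _ = sigma k \o (@tnth n R ^~ k)).
    by apply: measurableT_comp => //; exact: measurable_tnth.
  by apply/funext => v /=; rewrite tnth_mktuple.
exact: measurableT_comp.
Qed.

Lemma interim_seller_utility :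
  (\int[P]_(t in adm @^-1` [set I])
      (seller fmt (play sigma (admitted_valuations V I t)))%:E =
   P (adm @^-1` [set I]) * standard_seller_utility Q W fmt sigma)%E.
Proof.
pose f (v : n.-tuple R) : \bar R := (seller fmt (play sigma v))%:E.
have mf : measurable_fun setT f by apply/measurable_EFinP; exact: measurable_seller_play.
have H (g : n.-tuple R -> \bar R) : measurable_fun setT g -> (forall v, 0 <= g v)%E ->
    (\int[P]_(t in adm @^-1` [set I]) g (admitted_valuations V I t) =
     ('C(m, n)%:R^-1)%:E * \int[Q]_t g (W t))%E.
  move=> mg g0; have := ge0_integral_standard Hmodel nm WQ measurableT mg (fun v _ => g0 v).
  by rewrite !preimage_setT setIT.
rewrite /standard_seller_utility (prob_adm Hmodel nm).
rewrite -/(f _) [LHS]integralE [X in (_ * X)%E]integralE.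
rewrite -mule_subr_pos; last 3 first.
- by rewrite invr_gt0 binR_gt0.
- by apply: integral_ge0.
- by apply: integral_ge0.
congr (_ - _)%E.
  transitivity (\int[P]_(t in adm @^-1` [set I]) (f^\+)%E (admitted_valuations V I t))%E.
    by apply: eq_integral => t _; rewrite !funeposE.
  rewrite H//; last exact: measurable_funepos.
  by congr (_ * _)%E; apply: eq_integral => t _; rewrite !funeposE.
transitivity (\int[P]_(t in adm @^-1` [set I]) (f^\-)%E (admitted_valuations V I t))%E.
  by apply: eq_integral => t _; rewrite !funenegE.
rewrite H//; last exact: measurable_funeneg.
by congr (_ * _)%E; apply: eq_integral => t _; rewrite !funenegE.
Qed.

Lemma ex_ante_seller_utility :
  prescreening_seller_utility V adm fmt (fun=> sigma) = standard_seller_utility Q W fmt sigma.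
Proof.
have mVadm (B : set (n.-tuple R)) : measurable B ->
    measurable ((fun t => admitted_valuations V (adm t) t) @^-1` B).
  move=> mB; rewrite (_ : _ @^-1` B = \bigcup_(J in [set: nset m n])
      (adm @^-1` [set J] `&` admitted_valuations V J @^-1` B)).
    apply: fin_bigcup_measurable; first exact: finite_finset.
    move=> J _; apply: measurableI; first exact: (measurable_adm Hmodel).
    by apply: measurable_preimage => //; exact: measurable_admitted.
  apply/seteqP; split => t /=; first by move=> Bt; exists (adm t).
  by move=> [J _ [/= -> BJ]].
apply: (eq_law_integral (phi := fun t => admitted_valuations V (adm t) t) (phi' := W)
    (f := fun v => (seller fmt (play sigma v))%:E)) => //.
- by move=> _ B mB; rewrite setTI; exact: mVadm.
- move=> B mB; set U := _ @^-1` B; have mU : measurable U := mVadm B mB.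
  transitivity (\int[P]_(t in U) cst 1%E t)%E; first by rewrite integral_cst// mul1e.
  rewrite integral_mkcond (ge0_integral_admission Hmodel)//; last 2 first.
  - exact: (measurable_restrictT _ mU).1.
  - by move=> t; rewrite erestrict_ge0.
  transitivity (\sum_(J : nset m n) ('C(m, n)%:R^-1)%:E * Q (W @^-1` B))%E.
    apply: eq_bigr => J _; rewrite -integral_mkcondr integral_cst ?mul1e; last first.
      by apply: measurableI => //; exact: (measurable_adm Hmodel).
    rewrite (_ : _ `&` U = adm @^-1` [set J] `&` admitted_valuations V J @^-1` B).
      (* [WQ] is stated for I but serves every J: [joint_density F J] and [joint_density F I] are
         convertible. *)
      exact: (prob_standard (I := J) Hmodel nm WQ mB).
    by apply/seteqP; split => t [/= admJ]; rewrite /U/= admJ.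
  rewrite -ge0_sume_distrl; last by move=> J _; rewrite lee_fin invr_ge0.
  have C1 : 'C(m, n)%:R^-1 *+ 'C(m, n) = 1 :> R.
    by rewrite -[LHS]mulr_natl mulfV// lt0r_neq0// binR_gt0.
  by rewrite sumEFin sumr_const card_nset C1 mul1e.
- by apply/measurable_EFinP; exact: measurable_seller_play.
Qed.

End Seller.

(** Optimality is expressed through the belief alone; the environment enters the definition only in
    [is_belief]. *)
Lemma equilibrium_standard dA (A : measurableType dA) (fmt : auction_format R n A)
    (sigma : strategy_profile R n A) :
  equilibrium P (adm @^-1` [set I]) (admitted_valuations V I) fmt sigma <->
  standard_equilibrium Q W fmt sigma.
Proof.
by split=> H k; have [b bb bopt] := H k; exists b => //; apply/is_belief_standard.
Qed.

End Density.

Theorem theorem1 (R : realType) (m n : nat) (F : predictor R) (I : nset m n)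
    (d : measure_display) (T : measurableType d) (P : probability T R)
    (V S : 'I_m -> {RV P >-> R}) (adm : T -> nset m n)
    (Hm : (2 <= m)%N) (Hn : (2 <= n <= m)%N)
    (Hmodel : prescreening F V S adm) :
  let g := joint_density F I in
  let beta := bayes_posterior F I in
  let E := adm @^-1` [set I] in
  let VI := admitted_valuations V I in
  (* (i) *)
  [/\ is_density g /\ is_symmetric g,
      (* Bayes' rule does compute the posterior of the model, *)
      forall k, is_belief P E VI k (beta k),
      (* it agrees with the conditional densities of g at every point, *)
      forall k v, cube R n v ->
        cond_density g k (tnth v k) (others k v) = beta k (tnth v k) (others k v),
      (* as does, almost everywhere, any version of the posterior density, *)
      forall k b, is_belief P E VI k b ->
        {ae tuple_lebesgue R n, forall v, cube R n v ->
          cond_density g k (tnth v k) (others k v) = b (tnth v k) (others k v)} &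
      (* and g is the only such symmetric density. *)
      forall (h : n.-tuple R -> R) (b : 'I_n -> R -> n.-1.-tuple R -> R),
        is_density h -> is_symmetric h ->
        (forall k, is_belief P E VI k (b k)) ->
        (forall k, {ae tuple_lebesgue R n, forall v, cube R n v ->
          0 < marginal_density h k (tnth v k) ->
          cond_density h k (tnth v k) (others k v) = b k (tnth v k) (others k v)}) ->
        {ae tuple_lebesgue R n, forall v, cube R n v -> h v = g v}]
  /\
  (* (ii) *)
  (forall (d' : measure_display) (T' : measurableType d') (Q : probability T' R)
      (W : {mfun T' >-> n.-tuple R}),
    has_joint_density Q W g ->
    (* beliefs *)
    (forall k b, is_belief P E VI k b <-> is_belief Q setT W k b) /\
    (forall (dA : measure_display) (A : measurableType dA)
        (fmt : auction_format R n A),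
      [/\ (* equilibrium strategies, given that I is admitted and overall *)
          forall sigma : strategy_profile R n A,
            equilibrium P E VI fmt sigma <-> standard_equilibrium Q W fmt sigma,
          forall s : nset m n -> strategy_profile R n A,
            prescreening_equilibrium V adm fmt s <->
            (forall J, standard_equilibrium Q W fmt (s J)),
          (* seller's expected utility, ex ante and given that I is admitted *)
          forall sigma : strategy_profile R n A,
            prescreening_seller_utility V adm fmt (fun=> sigma) =
            standard_seller_utility Q W fmt sigma &
          forall sigma : strategy_profile R n A,
            (\int[P]_(t in E) (seller fmt (play sigma (VI t)))%:E =
             P E * standard_seller_utility Q W fmt sigma)%E])).

Proof.
move=> g beta E VI; have nm : (n <= m)%N by case/andP: Hn.
split; first split.
- by split; [exact: (is_density_joint Hmodel) | exact: is_symmetric_joint].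
- by move=> k; exact: (is_belief_bayes Hmodel).
- by move=> k v; exact: cond_density_bayes.
- by move=> k b; exact: (cond_density_belief Hmodel nm).
- move=> h b hd _ hb hcond.
  by apply: (density_unique Hmodel nm hd hb hcond); case/andP: Hn.
move=> d' T' Q W WQ; split; first by move=> k b; exact: (is_belief_standard Hmodel nm WQ).
move=> dA A fmt; split.
- by move=> sigma; exact: (equilibrium_standard Hmodel nm WQ).
- move=> s; split=> H J.
    exact: (equilibrium_standard (I := J) Hmodel nm WQ fmt (s J)).1 (H J).
  exact: (equilibrium_standard (I := J) Hmodel nm WQ fmt (s J)).2 (H J).
- by move=> sigma; exact: (ex_ante_seller_utility Hmodel nm WQ).
- by move=> sigma; exact: (interim_seller_utility Hmodel nm WQ).
Qed.
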